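(* Let $p$ be a prime, let $K$ be a finite extension of $\mathbb{Q}_p$ with valuation $v$ normalized by $v(p)=1$, let $c\in K^\times$, let $f(z)=z^p-c$, and let $a\in K$ be such that for every integer $n\ge 0$ the solutions of $f^n(z)=a$ in $\overline{K}$ are distinct. Let $K_\infty$ be the extension of $K$ generated by all solutions of $f^n(z)=a$ for all $n\ge 0$. (a) If $v(c)<-p/(p-1)$, then $K_\infty/K$ is a finite extension. (b) If $v(c)=-p/(p-1)$, then $K_\infty/K$ is an infinite extension, and $K_\infty/K$ is finitely ramified if and only if $a$ lies within the closed unit disk $\{x\in\overline{K}: v(x-b)\ge 0\}$ centered at a fixed point $b\in\overline{K}$ of $f$. (c) If $v(c)>-p/(p-1)$, then $K_\infty/K$ is infinitely wildly ramified.
   Context: Here $\overline{K}$ is an algebraic closure of $K$, $v$ is extended to $\overline{K}$ (with $v(0)=\infty$), and $f^n$ denotes the $n$-th iterate $f\circ\cdots\circ f$ (so $f^0(z)=z$). ''Finitely ramified'' means that the inertia subgroup of $\mathrm{Gal}(K_\infty/K)$ is finite, i.e. the ramification index $(v(K_\infty^\times):v(K^\times))$ is finite. ''Infinitely wildly ramified'' means that arbitrarily large powers of $p$ divide the ramification indices of finite subextensions of $K_\infty/K$. *)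

(* Defs.v *)
From HB Require Import structures.
From mathcomp Require Import all_boot all_order all_algebra all_field.
From mathcomp Require Import classical_sets constructive_ereal.

Set Implicit Arguments.
Unset Strict Implicit.
Unset Printing Implicit Defensive.

Import Order.TTheory GRing.Theory Num.Theory.

Local Open Scope classical_set_scope.
Local Open Scope ring_scope.

(* Values in rat lose no generality here: the valuation of an algebraic       *)
(* closure of Q_p normalized by v(p) = 1 has value group exactly Q.           *)
Record is_valuation (F : fieldType) (v : F -> \bar rat) : Prop := IsValuation {
  valuation_neq_ninfty : forall x, v x <> -oo%E;
  valuation_eq_pinfty : forall x, v x = +oo%E <-> x = 0;
  valuationM : forall x y, v (x * y) = (v x + v y)%E;
  valuationD : forall x y, (Order.min (v x) (v y) <= v (x + y)%R)%E }.

Definition v_cauchy (F : fieldType) (v : F -> \bar rat) (u : nat -> F) : Prop :=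
  forall M : rat, exists N : nat, forall m n : nat,
    (N <= m)%N -> (N <= n)%N -> (M%:E <= v (u m - u n)%R)%E.

Definition v_converges (F : fieldType) (v : F -> \bar rat)
    (u : nat -> F) (l : F) : Prop :=
  forall M : rat, exists N : nat, forall n : nat,
    (N <= n)%N -> (M%:E <= v (u n - l)%R)%E.

Definition padic_val_rat (p : nat) (q : rat) : rat :=
  (logn p `|numq q|)%:R - (logn p `|denq q|)%:R.

(* (F, v) is the completion of Q for the p-adic valuation, which determines   *)
(* it up to a unique isomorphism.                                             *)
Record is_padic_numbers (p : nat) (F : fieldType) (v : F -> \bar rat) : Prop :=
  IsPadicNumbers {
  padic_valuation : is_valuation v;
  padic_val_ratr : forall q : rat, q != 0 -> v (ratr q) = (padic_val_rat p q)%:E;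
  padic_dense : forall (x : F) (M : rat), exists q : rat,
    (M%:E <= v (x - ratr q)%R)%E;
  padic_complete : forall u : nat -> F, v_cauchy v u ->
    exists l : F, v_converges v u l }.

Definition poly_iter (F : fieldType) (f : {poly F}) (n : nat) : {poly F} :=
  iter n (fun g => f \Po g) 'X.

Definition solutions (F : fieldType) (f : {poly F}) (n : nat) (a : F) : set F :=
  [set z | root (poly_iter f n - a%:P) z].

(* All roots of q, counted with multiplicity, are pairwise distinct.          *)
Definition distinct_roots (F : closedFieldType) (q : {poly F}) : Prop :=
  exists2 s : seq F, q = lead_coef q *: \prod_(z <- s) ('X - z%:P) & uniq s.

Definition is_subfield (F : fieldType) (L : set F) : Prop :=
  divring_closed (mem L).

Definition field_gen (K F : fieldType) (iota : {rmorphism K -> F}) (S : set F) :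
    set F :=
  smallest (@is_subfield F) (range iota `|` S).

Definition K_infty (K F : fieldType) (iota : {rmorphism K -> F})
    (f : {poly F}) (a : F) : set F :=
  field_gen iota (\bigcup_n solutions f n a).

Definition finite_ext (K F : fieldType) (iota : {rmorphism K -> F})
    (L : set F) : Prop :=
  exists (n : nat) (b : 'I_n -> F), (forall i, L (b i)) /\
    forall x, L x -> exists k : 'I_n -> K, x = \sum_(i < n) iota (k i) * b i.

Definition finite_subext (K F : fieldType) (iota : {rmorphism K -> F})
    (M L : set F) : Prop :=
  [/\ is_subfield L, range iota `<=` L, L `<=` M & finite_ext iota L].

Definition value_group (F : fieldType) (v : F -> \bar rat) (L : set F) :
    set rat :=
  [set g | exists2 x, L x & v x = g%:E].

(* (A : B) = n, through a complete system of coset representatives.           *)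
Definition has_index (V : zmodType) (A B : set V) (n : nat) : Prop :=
  exists r : 'I_n -> V, (forall i, A (r i)) /\
    forall g, A g -> exists! i, B (g - r i).

Definition ramification_index (K F : fieldType) (iota : {rmorphism K -> F})
    (v : F -> \bar rat) (L : set F) (e : nat) : Prop :=
  has_index (value_group v L) (value_group v (range iota)) e.

Definition finitely_ramified (K F : fieldType) (iota : {rmorphism K -> F})
    (v : F -> \bar rat) (L : set F) : Prop :=
  exists e : nat, ramification_index iota v L e.

Definition infinitely_wildly_ramified (p : nat) (K F : fieldType)
    (iota : {rmorphism K -> F}) (v : F -> \bar rat) (M : set F) : Prop :=
  forall m : nat, exists (L : set F) (e : nat),
    [/\ finite_subext iota M L, ramification_index iota v L e &
        (p ^ m %| e)%N].

(* Main.v *)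
Require Import Defs.
From HB Require Import structures.
From mathcomp Require Import all_boot all_order all_algebra all_field.
From mathcomp Require Import classical_sets constructive_ereal.
From mathcomp Require Import boolp ring lra.

(** Throughout, [tau] is [1 / (p - 1)], the valuation of [1 - zeta] for a primitive
[p]-th root of unity [zeta].  Two points [x], [y] have images under
[z |-> z ^+ p - c] that differ by [x ^+ p - y ^+ p], the product of the
[x - zeta ^+ i * y].  These factors differ from one another by elements of
valuation [v y + tau].  So below this threshold they all have the same valuation
([subX_v_low]), while if the product has a valuation above [p] times the
threshold, one factor is closer to zero than all the others ([subX_vge_high]).
Everything is decided by the sign of the threshold along the backward orbit
of [a].

If [v c > - p * tau], points of the backward orbit end up in a region where the
threshold is bounded below by a positive number.  Two siblings [z], [zeta * z]
of this region differ by an element of positive valuation; pulling this pair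
back, the valuation of the difference decreases below the threshold, and from
then on it is exactly divided by [p] at every step ([pair_geometric]).  The value
group of a finite extension of [K] is generated by some [1 / n], and
ramification indices are quotients of such integers; hence arbitrarily large
powers of [p] divide them ([infinitely_wild]).

If [v c <= - p * tau], a fixed point [b] has valuation [v c / p], and the
threshold near [b] is [thr = v c / p + tau <= 0].  When [thr < 0], all points
far enough along the backward orbit are so close to [b] that each is the only one of its
conjugates near some [zeta ^+ i * b]; by Krasner's argument ([close_preimage])
taking further preimages does not enlarge the field.  When [thr = 0] and
[v (a - b) < 0], the valuation of [z - b] is divided by [p] at each step, so that
the value group has unbounded denominators.  When [thr = 0] and [v (a - b) >= 0],
the whole backward orbit stays in the unit disk around [b], and distinct points
of the same level lie in distinct residue classes ([level_separated]): the
residue field is infinite, but each preimage generates an unramified extension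
([unramified_preimage]).

Krasner's argument and the unramified case use that conjugate elements have the
same valuation ([conjugate_valuation]).  This comes from the equivalence of
norms on finite-dimensional spaces over the complete field of [p]-adic numbers
([bounded_coordinates]). *)

Set Implicit Arguments.
Unset Strict Implicit.
Unset Printing Implicit Defensive.

Import Order.TTheory GRing.Theory Num.Theory.
Local Open Scope classical_set_scope.
Local Open Scope ring_scope.

(** * Valuations *)

Section Valuation.

Variables (F : fieldType) (v : F -> \bar rat).
Hypothesis v_val : is_valuation v.

Definition vge (r : rat) (x : F) : Prop := (r%:E <= v x)%E.

Lemma v0 : v 0 = +oo%E.
Proof. by apply/(valuation_eq_pinfty v_val). Qed.

Lemma v_finite x : x != 0 -> exists s, v x = s%:E.
Proof.
move=> x0; case E: (v x) => [s| |]; first by exists s.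
  by move/(valuation_eq_pinfty v_val): E => xz; rewrite xz eqxx in x0.
by case: (valuation_neq_ninfty v_val E).
Qed.

Lemma v_neq0 x s : v x = s%:E -> x != 0.
Proof. by move=> vx; apply/eqP => x0; rewrite x0 v0 in vx. Qed.

Lemma vM x y s t : v x = s%:E -> v y = t%:E -> v (x * y) = (s + t)%:E.
Proof. by move=> vx vy; rewrite (valuationM v_val) vx vy. Qed.

Lemma v1 : v 1 = 0%:E.
Proof.
have [s vs] := v_finite (oner_neq0 F).
have := vM vs vs; rewrite mulr1 vs => -[] E; congr (_%:E); lra.
Qed.

Lemma vX x s n : v x = s%:E -> v (x ^+ n) = (n%:R * s)%:E.
Proof.
move=> vx; elim: n => [|n IH]; first by rewrite expr0 mul0r v1.
by rewrite exprS (vM vx IH) -[in RHS]natr1; congr (_%:E); ring.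
Qed.

Lemma vN x : v (- x) = v x.
Proof.
have [->|x0] := eqVneq x 0; first by rewrite oppr0.
have n0 : (-1 : F) != 0 by rewrite oppr_eq0 oner_neq0.
have [s vs] := v_finite n0; have := vM vs vs; rewrite mulrNN mulr1 v1 => -[] E.
have {}E : s = 0 by lra.
by have [t vt] := v_finite x0; rewrite -mulN1r (vM vs vt) vt E add0r.
Qed.

Lemma vV x s : v x = s%:E -> v x^-1 = (- s)%:E.
Proof.
move=> vx; have x0 := v_neq0 vx; have : x^-1 != 0 by rewrite invr_eq0.
move=> /v_finite[t vt]; have := vM vx vt; rewrite divff // v1 => -[] E.
by rewrite vt; congr (_%:E); lra.
Qed.

Lemma v_div x y s t : v x = s%:E -> v y = t%:E -> v (x / y) = (s - t)%:E.
Proof. by move=> vx /vV; apply: vM. Qed.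

Lemma v_prod_const I (r : seq I) (f : I -> F) s :
  (forall i, v (f i) = s%:E) -> v (\prod_(i <- r) f i) = ((size r)%:R * s)%:E.
Proof.
move=> vf; elim: r => [|i r IH]; first by rewrite big_nil mul0r v1.
by rewrite big_cons (vM (vf i) IH) /= -[in RHS]natr1; congr (_%:E); ring.
Qed.

Lemma vge_eq r x s : v x = s%:E -> vge r x <-> r <= s.
Proof. by rewrite /vge => ->; rewrite lee_fin. Qed.

Lemma vgeP r x : vge r x \/ exists2 s, v x = s%:E & s < r.
Proof.
have [->|/v_finite[s vs]] := eqVneq x 0; first by left; rewrite /vge v0 leey.
have [h|h] := leP r s; first by left; apply/(vge_eq r vs).
by right; exists s.
Qed.

Lemma vge_inj x y : (forall r, vge r x <-> vge r y) -> v x = v y.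
Proof.
move=> h.
have [x0|/v_finite[s vs]] := eqVneq x 0; have [y0|/v_finite[t vt]] := eqVneq y 0.
- by rewrite x0 y0.
- have /h/(vge_eq _ vt) : vge (t + 1) x by rewrite /vge x0 v0 leey.
  by rewrite gerDl ler10.
- have /h/(vge_eq _ vs) : vge (s + 1) y by rewrite /vge y0 v0 leey.
  by rewrite gerDl ler10.
have /h/(vge_eq _ vt) st := proj2 (vge_eq _ vs) (lexx s).
have /h/(vge_eq _ vs) ts := proj2 (vge_eq _ vt) (lexx t).
by rewrite vs vt (le_anti (introT andP (conj st ts))).
Qed.

Lemma vge_le r s x : r <= s -> vge s x -> vge r x.
Proof. by move=> rs; apply: le_trans; rewrite lee_fin. Qed.

Lemma vge0 r : vge r 0.
Proof. by rewrite /vge v0 leey. Qed.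

Lemma vgeN r x : vge r (- x) <-> vge r x.
Proof. by rewrite /vge vN. Qed.

Lemma vgeD r x y : vge r x -> vge r y -> vge r (x + y).
Proof.
move=> rx ry; apply: le_trans (valuationD v_val x y).
by rewrite le_min; apply/andP.
Qed.

Lemma vgeB r x y : vge r x -> vge r y -> vge r (x - y).
Proof. by move=> rx ry; apply: vgeD => //; apply/vgeN. Qed.

Lemma vge_sum r (I : Type) (l : seq I) (P : pred I) (f : I -> F) :
  (forall i, P i -> vge r (f i)) -> vge r (\sum_(i <- l | P i) f i).
Proof. by move=> h; apply: big_ind => //; [exact: vge0|exact: vgeD]. Qed.

Lemma vgeM r s x y : vge r x -> vge s y -> vge (r + s) (x * y).
Proof.
have [->|/v_finite[a vx]] := eqVneq x 0; first by rewrite mul0r => *; apply: vge0.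
have [->|/v_finite[b vy]] := eqVneq y 0; first by rewrite mulr0 => *; apply: vge0.
move=> /(vge_eq r vx) ra /(vge_eq s vy) sb; apply/(vge_eq _ (vM vx vy)); lra.
Qed.

Lemma vgeX r n x : vge r x -> vge (n%:R * r) (x ^+ n).
Proof.
move=> rx; elim: n => [|n IH]; first by rewrite expr0 mul0r /vge v1.
by rewrite exprS -natr1 mulrDl mul1r addrC; apply: vgeM.
Qed.

Lemma vge_prod (I : Type) (l : seq I) (f : I -> F) r :
  (forall i, vge r (f i)) -> vge ((size l)%:R * r) (\prod_(i <- l) f i).
Proof.
move=> rf; elim: l => [|i l IH]; first by rewrite big_nil mul0r /vge v1.
by rewrite big_cons /= -natr1 mulrDl mul1r addrC; apply: vgeM.
Qed.

Lemma vgeM0 r x y : vge 0 x -> vge r y -> vge r (x * y).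
Proof. by move=> hx hy; have := vgeM hx hy; rewrite add0r. Qed.

Lemma vge_nat n : vge 0 n%:R.
Proof.
elim: n => [|n IH]; first exact: vge0.
by rewrite -natr1; apply: vgeD => //; rewrite /vge v1.
Qed.

Lemma vge_int (n : int) : vge 0 n%:~R.
Proof.
case: n => n; first exact: vge_nat.
by rewrite NegzE mulrNz; apply/vgeN/vge_nat.
Qed.

Lemma vDl x y s t : v x = s%:E -> s < t -> vge t y -> v (x + y) = s%:E.
Proof.
move=> vx st ty.
have h : vge s (x + y).
  by apply: vgeD; [apply/(vge_eq _ vx) | apply: vge_le ty; apply: ltW].
have xy0 : x + y != 0.
  apply/eqP => /eqP; rewrite addr_eq0 => /eqP xy.
  by move/vgeN: ty; rewrite -xy => /(vge_eq _ vx); rewrite leNgt st.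
have [u vu] := v_finite xy0; rewrite vu; congr (_%:E); apply/eqP.
move/(vge_eq _ vu): h => su; rewrite eq_le su andbT leNgt; apply/negP => su'.
have [w [uw ws]] : exists w, s < w /\ (w <= u /\ w <= t).
  by exists (Num.min u t); rewrite lt_min su' st !ge_min !lexx ?orbT.
have : vge w x.
  have -> : x = (x + y) - y by rewrite addrK.
  apply: vgeB; first by apply/(vge_eq _ vu); case: ws.
  by apply: vge_le ty; case: ws.
by move/(vge_eq _ vx); rewrite leNgt uw.
Qed.

(** Otherwise the single term of least valuation would dominate the sum. *)
Lemma v_sum_eq0 n (f : 'I_n -> F) :
  \sum_i f i = 0 -> (exists i, f i != 0) ->
  exists i j s, [/\ i != j, v (f i) = s%:E & v (f j) = s%:E].
Proof.
move=> f0 [i0 fi0].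
pose vr i := fine (v (f i)).
have vrE i : f i != 0 -> v (f i) = (vr i)%:E.
  by move=> /v_finite[s vs]; rewrite /vr vs.
have [i fi mi] := @arg_minP _ _ _ i0 (fun i => f i != 0) vr fi0.
apply: contrapT => no.
have [t it ht] : exists2 t, vr i < t & forall j, j != i -> vge t (f j).
  have : forall l : seq 'I_n,
      exists2 t, vr i < t & forall j, j \in l -> j != i -> vge t (f j).
    elim=> [|j l [t it ht]]; first by exists (vr i + 1) => //; lra.
    have [fj0|fj0] := eqVneq (f j) 0.
      exists t => // k; rewrite inE => /predU1P[->|]; last exact: ht.
      by rewrite fj0 => _; apply: vge0.
    have ij := mi j fj0; have [ji|ji] := eqVneq j i.
      by exists t => // k; rewrite inE ji => /predU1P[->|]; [rewrite eqxx | exact: ht].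
    have {}ij : vr i < vr j.
      rewrite lt_neqAle ij andbT; apply/eqP => E; apply: no.
      by exists i, j, (vr i); split; rewrite ?vrE // ?E // eq_sym.
    exists (Num.min t (vr j)); first by rewrite lt_min it.
    move=> k; rewrite inE => /predU1P[-> _|kl ki].
      by apply/(vge_eq _ (vrE _ fj0)); rewrite ge_min lexx orbT.
    by apply: vge_le (ht k kl ki); rewrite ge_min lexx.
  by move=> /(_ (enum 'I_n))[t it ht]; exists t => // j; apply: ht; rewrite mem_enum.
have := v0; rewrite -f0 (bigD1 i) //=.
by rewrite (vDl (vrE _ fi) it) //; apply: vge_sum.
Qed.

End Valuation.

(** * The field of p-adic numbers *)

Lemma rat_le_nat (x : rat) : exists n : nat, x <= n%:R.
Proof.
exists (Num.Def.archi_bound `|x|); apply: le_trans (ler_norm x) _.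
exact/ltW/archi_boundP.
Qed.

Section PadicNumbers.

Variables (p : nat) (p_prime : prime p).
Variables (Qp : fieldType) (vp : Qp -> \bar rat).
Hypothesis hQp : is_padic_numbers p vp.

Let vp_val := padic_valuation hQp.

Let ratr0 : ratr 0 = 0 :> Qp := ratr_nat Qp 0.

Lemma vp_p : vp p%:R = 1%:E.
Proof.
have p0 : (p%:R : rat) != 0 by rewrite pnatr_eq0 -lt0n prime_gt0.
rewrite -(ratr_nat Qp p) (padic_val_ratr hQp p0) /padic_val_rat.
have -> : (p%:R : rat) = (p%:Z)%:~R by [].
by rewrite numq_int denq_int /= logn1 lognE p_prime prime_gt0 // dvdnn divnn
  prime_gt0 // logn1 subr0.
Qed.

Lemma vp_int y : y != 0 -> exists n : int, vp y = (n%:~R)%:E.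
Proof.
move=> /(v_finite vp_val)[s vs]; have [q hq] := padic_dense hQp y (s + 1).
have vq : vp (ratr q) = s%:E.
  have -> : ratr q = y - (y - ratr q) by ring.
  by apply: (vDl vp_val vs) _ (_ : vge vp (s + 1) _); [lra | apply/(vgeN vp_val)].
have q0 : q != 0 by apply: contra_eq_neq vq => ->; rewrite ratr0 (v0 vp_val).
move: vq; rewrite (padic_val_ratr hQp q0) vs => -[] <-.
by exists ((logn p `|numq q|)%:Z - (logn p `|denq q|)%:Z); rewrite rmorphB.
Qed.

Lemma vge_dvdz k (n : int) : ((p ^ k)%N %| n)%Z -> vge vp k%:R (n%:~R : Qp).
Proof.
move=> /dvdzP[m ->]; rewrite rmorphM /= -[k%:R]add0r.
apply: (vgeM vp_val); first exact: vge_int.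
rewrite -[(_ : int)%:~R]/((p ^ k)%N%:R : Qp) natrX.
by apply/(vge_eq _ (vX vp_val k vp_p)); rewrite mulr1.
Qed.

(** Approximate [y] by a rational number; its denominator is prime to [p], hence
invertible modulo [p ^ k] by a Bezout relation. *)
Lemma padic_residue (y : Qp) k :
  vge vp 0 y -> exists2 j, (j < p ^ k)%N & vge vp k%:R (y - j%:R).
Proof.
move=> y_int; have [q yq] := padic_dense hQp y k%:R.
have pk0 : (0 < p ^ k)%N by rewrite expn_gt0 prime_gt0.
have q_int : vge vp 0 (ratr q).
  have -> : ratr q = y - (y - ratr q) by ring.
  by apply: (vgeB vp_val) => //; apply: vge_le yq; apply: ler0n.
have [q0|q0] := eqVneq q 0.
  by exists 0%N => //; move: yq; rewrite q0 ratr0.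
set d := denq q; set n := numq q.
have pd : ~~ (p %| `|d|)%N.
  apply/negP => pd.
  have pn : ~~ (p %| `|n|)%N.
    apply/negP => pn; have := coprime_num_den q.
    rewrite -/n -/d => /eqP g1.
    have : (p %| gcdn `|n| `|d|)%N by rewrite dvdn_gcd pn.
    by rewrite g1 dvdn1 => /eqP p1; move: p_prime; rewrite p1.
  move: q_int; rewrite (vge_eq _ (padic_val_ratr hQp q0)) /padic_val_rat.
  rewrite -/n -/d subr_ge0 ler_nat leqNgt => /negP; apply.
  have d0 : (0 < `|d|)%N by rewrite absz_gt0 denq_neq0.
  have -> : logn p `|n| = 0%N.
    by apply/eqP; rewrite -leqn0 leqNgt logn_gt0 mem_primes (negbTE pn) !andbF.
  by rewrite logn_gt0 mem_primes p_prime d0.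
have dr0 : (d%:~R : Qp) != 0.
  have h : (d%:~R : rat) != 0 by rewrite intr_eq0 denq_neq0.
  by rewrite -(ratr_int Qp); apply: (v_neq0 vp_val (padic_val_ratr hQp h)).
have vd : vp (d%:~R : Qp) = 0%:E.
  have h : (d%:~R : rat) != 0 by rewrite intr_eq0 denq_neq0.
  rewrite -(ratr_int Qp) (padic_val_ratr hQp h) /padic_val_rat.
  rewrite numq_int denq_int /= logn1 subr0.
  suff -> : logn p `|d| = 0%N by [].
  by apply/eqP; rewrite -leqn0 leqNgt logn_gt0 mem_primes (negbTE pd) !andbF.
have cop : coprimez d (p ^ k)%N%:Z.
  by rewrite coprimezE /= coprime_sym; apply: coprimeXl; rewrite prime_coprime.
have [[u w] /= uw] := coprimezP _ _ cop.
pose jz := ((n * u) %% (p ^ k)%N)%Z.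
have pkz : ((p ^ k)%N%:Z : int) != 0 by rewrite -lt0n.
have jz0 : 0 <= jz by rewrite modz_ge0.
have jzE : jz = `|jz|%N :> int by rewrite gez0_abs.
exists `|jz|%N; first by rewrite -ltz_nat -jzE ltz_pmod // ltz_nat.
have -> : y - (`|jz|%N)%:R = (y - ratr q) + (ratr q - (`|jz|%N)%:R) by ring.
apply: (vgeD vp_val) => //.
have -> : ratr q - (`|jz|%N)%:R = ((n - jz * d)%:~R : Qp) / d%:~R.
  rewrite rmorphB rmorphM /= -/d -/n {2}jzE.
  rewrite -[ratr q]/((numq q)%:~R / (denq q)%:~R) -/n -/d mulrBl mulfK //.
rewrite -[k%:R]addr0; apply: (vgeM vp_val).
  apply: vge_dvdz; apply/dvdzP.
  exists (n * w + (n * u %/ (p ^ k)%N)%Z * d).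
  have := divz_eq (n * u) (p ^ k)%N; rewrite -/jz.
  set D := (_ %/ _)%Z => E.
  have -> : jz = n * u - D * (p ^ k)%N by rewrite E; ring.
  have -> : n - (n * u - D * (p ^ k)%N) * d =
    n * (1 - u * d) + D * (p ^ k)%N * d by ring.
  rewrite -uw; ring.
by apply/(vge_eq _ (vV vp_val vd)); rewrite oppr0.
Qed.

(** * Finite-dimensional spaces over the p-adic numbers *)

Variables (F : fieldType) (j0 : {rmorphism Qp -> F}) (v : F -> \bar rat).
Hypothesis v_val : is_valuation v.
Hypothesis v_ext : forall x, v (j0 x) = vp x.

Definition lin_comb n (e : 'I_n -> F) (y : 'I_n -> Qp) : F :=
  \sum_i j0 (y i) * e i.

Lemma lin_comb_le n (e : 'I_n -> F) :
  exists C, forall y r, (forall i, vge vp r (y i)) -> vge v (r - C) (lin_comb e y).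
Proof.
have [C hC] : exists C, forall i, vge v (- C) (e i).
  have : forall l : seq 'I_n, exists C, forall i, i \in l -> vge v (- C) (e i).
    elim=> [|i l [C hC]]; first by exists 0.
    have [D hD] : exists D, vge v (- D) (e i).
      have [|[s vs _]] := vgeP v_val 0 (e i); first by exists 0; rewrite oppr0.
      by exists (- s); rewrite opprK; apply/(vge_eq _ vs).
    exists (Num.max C D) => k; rewrite inE => /predU1P[->|kl].
      by apply: vge_le hD; rewrite lerN2 le_max lexx orbT.
    by apply: vge_le (hC k kl); rewrite lerN2 le_max lexx.
  by move=> /(_ (enum 'I_n))[C hC]; exists C => i; apply: hC; rewrite mem_enum.
exists C => y r hy; apply: (vge_sum v_val) => i _; apply: (vgeM v_val) => //.
by rewrite /vge v_ext; apply: hy.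
Qed.

(** By the ultrametric inequality the partial sums form a Cauchy sequence. *)
Lemma padic_series (u : nat -> Qp) (C : rat) :
  (forall k, vge vp (k%:R - C) (u k)) ->
  exists l, forall k, vge vp (k%:R - C) (l - \sum_(i < k) u i).
Proof.
move=> hu; pose S k := \sum_(i < k) u i.
have tail k m : vge vp (k%:R - C) (S (k + m)%N - S k).
  elim: m => [|m IH]; first by rewrite addn0 subrr; apply: vge0.
  rewrite /S addnS big_ord_recr /= -/(S _) addrAC; apply: (vgeD vp_val) => //.
  by apply: vge_le (hu _); rewrite lerD2r ler_nat leq_addr.
have [M|l hl] := padic_complete hQp (u := S).
  have [k hk] := rat_le_nat (M + C); exists k => m n km kn.
  have Mk : M <= k%:R - C by lra.
  have -> : S m - S n = (S (k + (m - k))%N - S k) - (S (k + (n - k))%N - S k).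
    by rewrite !subnKC //; ring.
  exact: vge_le Mk (vgeB vp_val (tail _ _) (tail _ _)).
exists l => k; have [N hN] := hl (k%:R - C).
have -> : l - S k = (S (k + N)%N - S k) - (S (k + N)%N - l) by ring.
by apply: (vgeB vp_val) => //; apply: hN; apply: leq_addl.
Qed.

(** The equivalence of norms on a finite-dimensional space: coordinates are
bounded by the vector.  In the inductive step, were the last generator a limit
of combinations of the others, the completeness of the base field would make it
one of these combinations. *)
Lemma bounded_coordinates n (e : 'I_n -> F) :
  exists C, forall y r, vge v r (lin_comb e y) ->
    exists2 y', lin_comb e y' = lin_comb e y & forall i, vge vp (r - C) (y' i).
Proof.
elim: n e => [|n IH] e.
  by exists 0 => y r _; exists y => // -[].
pose e' i := e (widen_ord (leqnSn n) i); pose x := e ord_max.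
pose ext (y : 'I_n -> Qp) t (i : 'I_n.+1) := 
  if insub (val i) is Some k then y k else t.
have extE y t : lin_comb e (ext y t) = lin_comb e' y + j0 t * x.
  rewrite /lin_comb big_ord_recr /=; congr (_ + _ * _).
    apply: eq_bigr => i _; rewrite /ext /=; case: insubP => [k _ kE|].
      by have -> : k = i by apply: val_inj.
    by rewrite ltn_ord.
  by rewrite /ext /=; case: insubP => [k|]; rewrite ?ltnn.
have combE y : exists y' t, lin_comb e y = lin_comb e' y' + j0 t * x.
  exists (fun i => y (widen_ord (leqnSn n) i)), (y ord_max).
  by rewrite /lin_comb big_ord_recr.
have [C hC] := IH e'.
have [[y0 xE]|xV] := pselect (exists y0, x = lin_comb e' y0).
  exists C => y r; have [y1 [t ->]] := combE y.
  have -> : lin_comb e' y1 + j0 t * x = lin_comb e' (fun i => y1 i + t * y0 i).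
    rewrite xE /lin_comb mulr_sumr -big_split; apply: eq_bigr => i _ /=.
    by rewrite rmorphD rmorphM mulrDl mulrA.
  move=> /hC[y' <- hy']; exists (ext y' 0); first by rewrite extE raddf0 mul0r addr0.
  move=> i; rewrite /ext; case: insubP => [k _ _|_]; first exact: hy'.
  exact: vge0.
have [B hB] : exists B, forall y, ~ vge v B (x - lin_comb e' y).
  apply: contrapT => no; apply: xV.
  have /choice[w hw] : forall k : nat, exists y, vge v k%:R (x - lin_comb e' y).
    move=> k; apply: contrapT => nok; apply: no; exists k%:R => y hy.
    by apply: nok; exists y.
  have lcB y y' : lin_comb e' y - lin_comb e' y' = lin_comb e' (fun i => y i - y' i).
    rewrite /lin_comb -sumrB; apply: eq_bigr => i _.
    by rewrite rmorphB mulrBl.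
  have /choice[d hd] : forall k : nat, exists y,
      lin_comb e' y = lin_comb e' (w k.+1) - lin_comb e' (w k) /\
      forall i, vge vp (k%:R - C) (y i).
    move=> k; have : vge v k%:R (lin_comb e' (fun i => w k.+1 i - w k i)).
      rewrite -lcB.
      have -> : lin_comb e' (w k.+1) - lin_comb e' (w k) =
          (x - lin_comb e' (w k)) - (x - lin_comb e' (w k.+1)) by ring.
      apply: (vgeB v_val) => //; apply: vge_le (hw k.+1).
      by rewrite ler_nat.
    by move=> /hC[y yE hy]; exists y; split; rewrite ?lcB.
  have /choice[l hl] : forall i, exists l, forall k,
      vge vp (k%:R - C) (l - \sum_(m < k) d m i).
    by move=> i; apply: (@padic_series (fun m => d m i)) => k; case: (hd k).
  exists (fun i => w 0%N i + l i).
  have [D hD] := lin_comb_le e'.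
  have near_ (M : nat) : vge v M%:R (x - lin_comb e' (fun i => w 0%N i + l i)).
    have [k hk] := rat_le_nat (M%:R + `|C| + `|D|).
    have := ler_norm C; have := ler_norm D; have := normr_ge0 C.
    have := normr_ge0 D => D0 C0 DD CC.
    have wk : lin_comb e' (w k) =
        lin_comb e' (fun i => w 0%N i + \sum_(m < k) d m i).
      have : lin_comb e' (w k) - lin_comb e' (w 0%N) =
          lin_comb e' (fun i => \sum_(m < k) d m i).
        elim: k {hk} => [|k IHk].
          rewrite subrr /lin_comb big1 // => i _.
          by rewrite big_ord0 raddf0 mul0r.
        have -> : lin_comb e' (w k.+1) - lin_comb e' (w 0%N) =
          (lin_comb e' (w k) - lin_comb e' (w 0%N)) +
          (lin_comb e' (w k.+1) - lin_comb e' (w k)) by ring.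
        rewrite IHk -(proj1 (hd k)) /lin_comb -big_split.
        by apply: eq_bigr => i _; rewrite big_ord_recr rmorphD mulrDl.
      move/eqP; rewrite subr_eq => /eqP ->; rewrite addrC /lin_comb -big_split.
      by apply: eq_bigr => i _; rewrite rmorphD mulrDl.
    have -> : x - lin_comb e' (fun i => w 0%N i + l i) = (x - lin_comb e' (w k)) -
        (lin_comb e' (fun i => w 0%N i + l i) - lin_comb e' (w k)) by ring.
    apply: (vgeB v_val); first by apply: vge_le (hw k); lra.
    rewrite wk lcB.
    apply: (@vge_le _ _ _ (k%:R - C - D)); first by lra.
    apply: hD => i; have -> : w 0%N i + l i - (w 0%N i + \sum_(m < k) d m i) =
      l i - \sum_(m < k) d m i by ring.
    exact: hl.
  apply/eqP; rewrite -subr_eq0; apply/negPn/negP => /(v_finite v_val)[s vs].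
  have [M hM] := rat_le_nat (s + 1).
  by move/(vge_eq _ vs): (near_ M) => hs; have := le_trans hM hs; rewrite gerDl ler10.
have [bx hbx] : exists bx, vge v bx x.
  have [|[s vs _]] := vgeP v_val 0 x; first by exists 0.
  by exists s; apply/(vge_eq _ vs).
exists (Num.max B (Num.max C (C + B - bx))) => y r; have [y1 [t ->]] := combE y.
set z := (_ + _) => rz.
have tB : vge vp (r - B) t.
  have [->|t0] := eqVneq t 0; first exact: vge0.
  have jt0 : j0 t != 0 by rewrite fmorph_eq0.
  have [s vs] := v_finite v_val jt0.
  rewrite /vge -v_ext; apply/(vge_eq _ vs).
  have zE : x - lin_comb e' (fun i => - (t^-1 * y1 i)) = z / j0 t.
    rewrite /z mulrDl mulrAC divff // mul1r addrC; congr (_ + _).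
    rewrite /lin_comb mulr_suml -sumrN; apply: eq_bigr => i _.
    by rewrite rmorphN rmorphM fmorphV; field.
  have : ~ vge v B (z / j0 t) by rewrite -zE; apply: hB.
  have [//|[u vu uB] _] := vgeP v_val B (z / j0 t).
  have := vM v_val vu vs; rewrite divfK // => vz.
  move/(vge_eq _ vz): rz => ru; lra.
have lcw : vge v (Num.min r (r - B + bx)) (lin_comb e' y1).
  have -> : lin_comb e' y1 = z - j0 t * x by rewrite /z addrK.
  apply: (vgeB v_val); first by apply: vge_le rz; rewrite ge_min lexx.
  apply: (@vge_le _ _ _ (r - B + bx)); first by rewrite ge_min lexx orbT.
  by apply: (vgeM v_val) => //; rewrite /vge v_ext.
have [y' y'E hy'] := hC _ _ lcw.
exists (ext y' t); first by rewrite extE y'E.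
move=> i; rewrite /ext; case: insubP => [k _ _|_].
  apply: vge_le (hy' k); set m1 := Num.max _ _.
  have h1 : C <= m1 by rewrite !le_max lexx !orbT.
  have h2 : C + B - bx <= m1 by rewrite !le_max lexx !orbT.
  by rewrite lerBrDr le_min; apply/andP; split; lra.
apply: vge_le tB; set m1 := Num.max _ _.
have h1 : B <= m1 by rewrite !le_max lexx.
lra.
Qed.

End PadicNumbers.

(** * Finite extensions inside an algebraic closure *)

Section LocalExtensions.

Variables (p : nat) (p_prime : prime p).
Variables (Qp : fieldType) (vp : Qp -> \bar rat).
Hypothesis hQp : is_padic_numbers p vp.
Variables (F : closedFieldType) (j0 : {rmorphism Qp -> F}) (v : F -> \bar rat).
Hypothesis v_val : is_valuation v.
Hypothesis v_ext : forall x, v (j0 x) = vp x.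
Hypothesis F_alg : forall x, algebraicOver j0 x.

Let vp_val := padic_valuation hQp.

(** A finite extension of the p-adic numbers in [F] is an abstract finite
extension together with an embedding, rather than a subset of [F], so that
linear algebra and minimal polynomials over it are available. *)
Record local_ext := LocalExt {
  ext_sort :> fieldExtType Qp;
  emb : {rmorphism ext_sort -> F};
  emb_alg : forall x, emb x%:A = j0 x }.

Definition im (E : local_ext) : set F := range (emb E).

Lemma embZ (E : local_ext) x (y : E) : emb E (x *: y) = j0 x * emb E y.
Proof. by rewrite -mulr_algl rmorphM emb_alg. Qed.

Lemma im_subfield (E : local_ext) : is_subfield (im E).
Proof.
split=> [|x y|x y].
- by apply/mem_set; exists 1 => //; rewrite rmorph1.
- move=> /set_mem[a _ <-] /set_mem[b _ <-]; apply/mem_set.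
  by exists (a - b) => //; rewrite rmorphB.
- move=> /set_mem[a _ <-] /set_mem[b _ <-]; apply/mem_set.
  by exists (a / b) => //; rewrite fmorph_div.
Qed.

(** The field [E'] is [E(z)], presented as the image of the polynomials over [E]
under evaluation at [z]; [P] is the minimal polynomial of [z]. *)
Lemma adjoin (E : local_ext) (z : F) :
  exists (P : {poly E}) (E' : local_ext),
    [/\ P \is monic, irreducible_poly P & root (map_poly (emb E) P) z] /\
    [/\ im E `<=` im E', im E' z &
        forall y, im E' y <-> exists q : {poly E}, y = (map_poly (emb E) q).[z]].
Proof.
have dec : decidable_embedding (emb E) by move=> y; exact: pselect.
have alg : integralOver (emb E) z.
  apply/integral_algebraic; have [q q0 qz] := F_alg z.
  exists (map_poly (in_alg E) q); first by rewrite map_poly_eq0.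
  rewrite -map_poly_comp.
  have -> : map_poly (emb E \o in_alg E) q = map_poly j0 q.
    by apply: eq_map_poly => x /=; rewrite emb_alg.
  by [].
have [P [Pm Pz Pirr]] := minPoly_decidable_closure dec alg.
have P0 := monic_neq0 Pm.
pose L := SubFieldExtType Pz Pirr.
pose j : {rmorphism L -> F} := @subfx_inj _ _ (emb E) z P.
have jE x : j (x%:A : L) = emb E x by exact: subfx_inj_base.
pose L' : fieldExtType Qp := baseFieldType L.
pose j' : {rmorphism L' -> F} := j.
have jQ x : j' (x%:A : L') = j0 x.
  rewrite baseField_scaleE -(emb_alg E) /j' -jE; congr (j _).
exists P, (LocalExt jQ); split=> //; split.
- by move=> _ [x _ <-]; exists (x%:A : L).
- by exists (subfx_root (emb E) z P) => //; apply: subfx_inj_root.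
- move=> y; split=> [[x _ <-]|[q ->]].
    have [q ->] := @subfxE _ _ (emb E) z P x.
    by exists q; apply: (subfx_inj_eval Pz P0).
  by exists (subfx_eval (emb E) z P q) => //; apply: (subfx_inj_eval Pz P0).
Qed.

Lemma irreducible_dvd_root (E : local_ext) (P q : {poly E}) z :
  irreducible_poly P -> root (map_poly (emb E) P) z ->
  root (map_poly (emb E) q) z -> P %| q.
Proof.
move=> Pirr Pz qz; suffices /eqp_dvdl <-: gcdp P q %= P by apply: dvdp_gcdr.
have P0 : P != 0 by apply/eqP => P0; case: Pirr; rewrite P0 size_poly0.
have [_ Pmin] := Pirr; apply: Pmin; last exact: dvdp_gcdl.
rewrite gtn_eqF // -(size_map_poly (emb E)) gcdp_map /=.
rewrite (@root_size_gt1 _ z) ?root_gcd ?Pz //.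
by rewrite gcdp_eq0 negb_and map_poly_eq0 P0.
Qed.

Lemma emb_basis (E : local_ext) : exists n (e : 'I_n -> F),
  forall x, im E x <-> exists y, x = lin_comb j0 e y.
Proof.
pose X := vbasis (fullv : {vspace E}).
exists (\dim (fullv : {vspace E})), (fun i => emb E X`_i) => x; split.
  move=> [t _ <-]; exists (fun i => coord X i t).
  rewrite {1}(coord_vbasis (memvf t)) rmorph_sum.
  by apply: eq_bigr => i _; rewrite embZ.
move=> [y ->]; exists (\sum_i y i *: X`_i) => //.
by rewrite rmorph_sum; apply: eq_bigr => i _; rewrite embZ.
Qed.

(** By the equivalence of norms, the valuations of [q.[z]] and [q.[z']] differ by
a bounded amount; replacing [q] by its powers makes this bound vanish. *)
Lemma conjugate_valuation (E : local_ext) (P q : {poly E}) z z' :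
  irreducible_poly P ->
  root (map_poly (emb E) P) z -> root (map_poly (emb E) P) z' ->
  v (map_poly (emb E) q).[z] = v (map_poly (emb E) q).[z'].
Proof.
move=> Pirr.
suff half u u' r : root (map_poly (emb E) P) u -> root (map_poly (emb E) P) u' ->
    vge v r (map_poly (emb E) q).[u] -> vge v r (map_poly (emb E) q).[u'].
  by move=> Pz Pz'; apply: (vge_inj v_val) => r; split; apply: half.
move=> Pu Pu'.
have [_ [E' [_ [_ _ E'q]]]] := adjoin E u.
have [n [e eE]] := emb_basis E'.
have /choice[g gE] : forall i, exists g : {poly E}, e i = (map_poly (emb E) g).[u].
  move=> i; apply/E'q/eE; exists (fun k => (k == i)%:R).
  rewrite /lin_comb (bigD1 i) //= eqxx rmorph1 mul1r big1 ?addr0 //.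
  by move=> k /negbTE->; rewrite raddf0 mul0r.
have [C hC] := bounded_coordinates hQp v_val v_ext e.
pose e' i := (map_poly (emb E) (g i)).[u'].
have [D hD] := lin_comb_le v_val v_ext e'.
have bnd (h : {poly E}) s : vge v s (map_poly (emb E) h).[u] ->
    vge v (s - C - D) (map_poly (emb E) h).[u'].
  move=> hs; have [y yE] : exists y, (map_poly (emb E) h).[u] = lin_comb j0 e y.
    by apply/eE/E'q; exists h.
  rewrite yE in hs; have [y' y'E hy'] := hC y s hs.
  pose G := \sum_i (y' i)%:A *: g i : {poly E}.
  have GE w : (map_poly (emb E) G).[w] = \sum_i j0 (y' i) * (map_poly (emb E) (g i)).[w].
    rewrite /G raddf_sum horner_sum; apply: eq_bigr => i _.
    by rewrite /= map_polyZ /= hornerZ emb_alg.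
  have : root (map_poly (emb E) (h - G)) u.
    rewrite rootE rmorphB hornerD hornerN yE -y'E GE subr_eq0; apply/eqP.
    by apply: eq_bigr => i _; rewrite gE.
  move/(irreducible_dvd_root Pirr Pu)/dvdpP => [w hG].
  have -> : (map_poly (emb E) h).[u'] = lin_comb j0 e' y'.
    have -> : h = (h - G) + G by rewrite subrK.
    by rewrite hG rmorphD rmorphM hornerD hornerM (rootP Pu') mulr0 add0r GE.
  exact: hD.
move=> hr; have [//|[t vt tr]] := vgeP v_val r (map_poly (emb E) q).[u'].
have rt0 : 0 < r - t by rewrite subr_gt0.
have [m hm] := rat_le_nat ((C + D + 1) / (r - t)).
have := bnd (q ^+ m) (m%:R * r); rewrite rmorphXn !horner_exp.
move=> /(_ (vgeX v_val m hr)) /(vge_eq _ (vX v_val m vt)).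
rewrite ler_pdivrMr // in hm; lra.
Qed.

(** Powers of [x] whose valuations are distinct modulo the integers are linearly
independent over the p-adic numbers. In degree [d], two among [1, x, ..., x ^+ d]
therefore have valuations that differ by an integer, and [d`!] clears the
denominator of [v x]. *)
Lemma value_denominator (E : local_ext) : exists2 N : nat, (0 < N)%N &
  forall x s, im E x -> v x = s%:E -> exists k : int, N%:R * s = k%:~R.
Proof.
pose d := \dim (fullv : {vspace E}).
exists (d`!)%N; first exact: fact_gt0.
move=> _ s [x _ <-] vx; have x0 : x != 0.
  by rewrite -(fmorph_eq0 (emb E)); apply: (v_neq0 v_val vx).
have [q qE] : exists q : {poly Qp}, minPoly 1%VS x = map_poly (in_alg E) q.
  by apply/polyOver1P; apply: minPolyOver.
have q0 : q != 0.
  by rewrite -(map_poly_eq0 (in_alg E)) -qE monic_neq0 // monic_minPoly.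
have szq : (size q <= d.+1)%N.
  rewrite -(size_map_poly (in_alg E)) -qE size_minPoly ltnS.
  have := dim_Fadjoin (1%AS : {subfield E}) x; rewrite dimv1 muln1 => <-.
  exact: dimvS (subvf _).
pose f (i : 'I_(size q)) := j0 q`_i * emb E x ^+ i.
have f0 : \sum_i f i = 0.
  have := root_minPoly 1%AS x; rewrite qE => /rootP /(congr1 (emb E)).
  rewrite -horner_map /= -map_poly_comp raddf0.
  have -> : map_poly (emb E \o in_alg E) q = map_poly j0 q.
    by apply: eq_map_poly => y /=; rewrite emb_alg.
  rewrite horner_coef size_map_poly => h; rewrite -[RHS]h.
  by apply: eq_bigr => i _; rewrite coef_map.
have sq0 : (0 < size q)%N by rewrite size_poly_gt0.
have [|i [j [t [ij vi vj]]]] := v_sum_eq0 v_val f0.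
  exists (Ordinal (etrans (congr1 (leq^~ _) (prednK sq0)) (leqnn _))).
  rewrite /f /= mulf_neq0 ?expf_neq0 ?fmorph_eq0 // -lead_coefE lead_coef_eq0 //.
have term k u : v (f k) = u%:E -> exists n : int, u = n%:~R + (k : nat)%:R * s.
  move=> vk; have := v_neq0 v_val vk; rewrite mulf_eq0 negb_or => /andP[jk _].
  have qk : q`_k != 0 by rewrite fmorph_eq0 in jk.
  have [n vn] := vp_int hQp qk; exists n.
  have := vM v_val (etrans (v_ext _) vn) (vX v_val k vx).
  by rewrite -/(f k) vk => -[].
have [m tm] := term _ _ vi; have [n tn] := term _ _ vj.
wlog ltij : i j m n ij vi vj tm tn / (i < j)%N.
  move=> hw; case: (ltngtP i j) => [h|h|/val_inj h].
  - exact: (hw i j m n).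
  - by apply: (hw j i n m) => //; rewrite eq_sym.
  - by rewrite h eqxx in ij.
have /dvdn_fact/dvdnP[w ->] : (0 < j - i <= d)%N.
  by rewrite subn_gt0 ltij /= leq_subLR (leq_trans _ (leq_addl _ _)) // -ltnS (leq_trans (ltn_ord j)).
exists (w%:Z * (m - n)); rewrite natrM rmorphM -mulrA; congr (_ * _).
rewrite natrB ?(ltnW ltij) // rmorphB /=; lra.
Qed.

(** Take a subspace of greatest dimension among those that [emb] maps into [S]. *)
Lemma subspace_generated (E : local_ext) (S : set F) :
  S `<=` im E -> S 0 ->
  (forall x y, S x -> S y -> S (x + y)) -> (forall a x, S x -> S (j0 a * x)) ->
  exists n (b : 'I_n -> F), (forall i, S (b i)) /\
    forall x, S x -> exists y, x = lin_comb j0 b y.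
Proof.
move=> SE S0 SD SZ.
pose ok (U : {vspace E}) := forall t, t \in U -> S (emb E t).
have [U okU maxU] : exists2 U, ok U & forall W, ok W -> (\dim W <= \dim U)%N.
  pose Q n := `[< exists2 U, ok U & \dim U = n >].
  have Q0 : exists n, Q n.
    exists 0%N; apply/asboolP; exists 0%VS; last exact: dimv0.
    by move=> t; rewrite memv0 => /eqP->; rewrite raddf0.
  have Qb n : Q n -> (n <= \dim (fullv : {vspace E}))%N.
    by move=> /asboolP[U _ <-]; apply: dimvS; apply: subvf.
  case: (ex_maxnP Q0 Qb) => n /asboolP[U okU <-] maxn.
  by exists U => // W okW; apply: maxn; apply/asboolP; exists W.
pose X := vbasis U.
exists (\dim U), (fun i => emb E X`_i); split.
  by move=> i; apply: okU; apply: vbasis_mem; rewrite mem_nth ?size_tuple.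
move=> x Sx; have [t _ tx] := SE x Sx.
have tU : t \in U.
  have okUt : ok (U + <[t]>)%VS.
    move=> w /memv_addP[w1 w1U [w2 /vlineP[k ->] ->]]; rewrite rmorphD embZ.
    by apply: SD; [apply: okU | apply: SZ; rewrite tx].
  have := maxU _ okUt; rewrite (geq_leqif (dimv_leqif_sup (addvSl U <[t]>%VS))).
  by rewrite subv_add => /andP[_]; rewrite -memvE.
exists (fun i => coord X i t); rewrite -tx {1}(coord_vbasis tU) rmorph_sum.
by apply: eq_bigr => i _; rewrite embZ.
Qed.

(** Finiteness of the residue field: by [bounded_coordinates], the coordinates of
an integral element have bounded denominators, and they determine its residue
class as soon as they are known modulo a fixed power of [p]. *)
Lemma finite_residue (E : local_ext) : exists M : nat, forall s : seq F,
  (forall x, x \in s -> im E x) -> uniq s ->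
  (forall x y, x \in s -> y \in s -> x != y -> v (x - y) = 0%:E) ->
  (size s <= M)%N.
Proof.
have [n [e eE]] := emb_basis E.
have [C hC] := bounded_coordinates hQp v_val v_ext e.
have [D hD] := lin_comb_le v_val v_ext e.
have [k kC] := rat_le_nat C.
have [m mk] := rat_le_nat (k%:R + D + 1).
pose T := {ffun 'I_n -> 'I_(p ^ m)}.
have pk0 : (0 < p ^ m)%N by rewrite expn_gt0 prime_gt0.
exists #|{: T}| => -[//|x0 s'] sE us sv; set s := x0 :: s' in sE us sv *.
have xs0 : x0 \in s by rewrite mem_head.
have vpk (l : nat) : vp (p%:R ^+ l) = l%:R%:E by rewrite (vX vp_val l (vp_p p_prime hQp)) mulr1.
have /choice[t ht] : forall x, exists t : T, x \in s -> exists2 y,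
    x - x0 = lin_comb j0 e y & forall i, vge vp m%:R (p%:R ^+ k * y i - (t i)%:R).
  move=> x; have [xs|xs] := boolP (x \in s); last by exists [ffun=> Ordinal pk0].
  have x_int : vge v 0 (x - x0).
    have [->|xx0] := eqVneq x x0; first by rewrite subrr; apply: vge0.
    by apply/(vge_eq _ (sv _ _ xs xs0 xx0)).
  have [y yE] : exists y, x - x0 = lin_comb j0 e y.
    apply/eE/set_mem; have [_ sub _] := im_subfield E.
    by apply: sub; apply/mem_set; apply: sE.
  rewrite yE in x_int; have [y' y'E hy'] := hC y 0 x_int.
  have /choice[j hj] : forall i, exists j : 'I_(p ^ m),
      vge vp m%:R (p%:R ^+ k * y' i - j%:R).
    move=> i; have int_i : vge vp 0 (p%:R ^+ k * y' i).
      apply: (@vge_le _ _ _ (k%:R + (0 - C))); first by lra.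
      by apply: (vgeM vp_val) => //; apply/(vge_eq _ (vpk k)).
    have [j jp hj] := padic_residue p_prime hQp m int_i.
    by exists (Ordinal jp).
  exists [ffun i => j i] => _; exists y'; first by rewrite yE y'E.
  by move=> i; rewrite ffunE.
have t_inj : {in s &, injective t}.
  move=> x x' xs xs' tE; apply/eqP/negPn/negP => xx'.
  have [y yE hy] := ht x xs; have [y' y'E hy'] := ht x' xs'.
  have xE : x - x' = lin_comb j0 e (fun i => y i - y' i).
    have -> : x - x' = (x - x0) - (x' - x0) by ring.
    rewrite yE y'E /lin_comb -sumrB; apply: eq_bigr => i _.
    by rewrite rmorphB mulrBl.
  have h i : vge vp (m%:R - k%:R) (y i - y' i).
    have -> : y i - y' i = (p%:R ^+ k * y i - p%:R ^+ k * y' i) / p%:R ^+ k.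
      by rewrite -mulrBr mulrC mulKf // (v_neq0 vp_val (vpk k)).
    apply: (vgeM vp_val); last by apply/(vge_eq _ (vV vp_val (vpk k))).
    have -> : p%:R ^+ k * y i - p%:R ^+ k * y' i =
      (p%:R ^+ k * y i - (t x i)%:R) - (p%:R ^+ k * y' i - (t x' i)%:R).
      by rewrite tE; ring.
    exact: (vgeB vp_val).
  have := hD _ _ h; rewrite -xE => /(vge_eq _ (sv _ _ xs xs' xx')); lra.
rewrite -(size_map t) -(card_uniqP _) ?max_card //.
by rewrite map_inj_in_uniq.
Qed.

End LocalExtensions.

(** * Value groups and ramification indices *)

(** The least positive element generates [A]; it is the inverse of an integer
because [A] contains [1]. *)
Lemma discrete_subgroup (A : set rat) (N : nat) : (0 < N)%N ->
  A 1 -> (forall x y, A x -> A y -> A (x - y)) ->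
  (forall x, A x -> exists k : int, N%:R * x = k%:~R) ->
  exists2 n : nat, (0 < n)%N & forall x, A x <-> exists k : int, x = k%:~R / n%:R.
Proof.
move=> N0 A1 AB Aden.
have A0 : A 0 by rewrite -(subrr 1); apply: AB.
have AN x : A x -> A (- x) by move=> Ax; rewrite -sub0r; apply: AB.
have AD x y : A x -> A y -> A (x + y).
  by move=> Ax Ay; rewrite -[y]opprK; apply: AB => //; apply: AN.
have AMn x (n : nat) : A x -> A (n%:R * x).
  move=> Ax; elim: n => [|n IH]; first by rewrite mul0r.
  by rewrite -natr1 mulrDl mul1r; apply: AD.
have AMz x (k : int) : A x -> A (k%:~R * x).
  move=> Ax; case: k => k; first exact: AMn.
  by rewrite NegzE mulrNz mulNr; apply/AN/AMn.
have Nr0 : (N%:R : rat) != 0 by rewrite pnatr_eq0 -lt0n.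
pose P (m : nat) := (0 < m)%N && `[< A (m%:R / N%:R) >].
have PN : exists m, P m by exists N; rewrite /P N0; apply/asboolP; rewrite divff.
case: (ex_minnP PN) => m /andP[m0 /asboolP Am] mmin.
have mr0 : (m%:R : rat) != 0 by rewrite pnatr_eq0 -lt0n.
have mz0 : (m%:Z : int) != 0 by rewrite -lt0n in m0 *; case: m m0 {mmin Am mr0}.
have mult x : A x -> exists k : int, x = k%:~R * (m%:R / N%:R).
  move=> Ax; have [k kE] := Aden x Ax.
  have xE : x = k%:~R / N%:R by rewrite -kE mulrC mulKf.
  exists (k %/ m)%Z; pose r := (k %% m)%Z.
  have r0 : 0 <= r by rewrite modz_ge0.
  have rm : r < m by rewrite ltz_pmod.
  have krE : k = (k %/ m)%Z * m + r := divz_eq k m.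
  have kq : k%:~R = (k %/ m)%Z%:~R * m%:R + r%:~R :> rat.
    by rewrite [in LHS]krE rmorphD rmorphM.
  have Ar : A ((`|r|%N)%:R / N%:R).
    have -> : (`|r|%N)%:R / N%:R = x - (k %/ m)%Z%:~R * (m%:R / N%:R) :> rat.
      have -> : (`|r|%N)%:R = r%:~R :> rat by rewrite -[in RHS](gez0_abs r0).
      by rewrite xE kq; field.
    by apply: AB => //; apply: AMz.
  have [rz|rnz] := posnP `|r|%N.
    move/eqP: rz; rewrite absz_eq0 => /eqP rz.
    by rewrite xE kq rz addr0 mulrA.
  have : (m <= `|r|)%N by apply: mmin; rewrite /P rnz; apply/asboolP.
  by rewrite -lez_nat gez0_abs // leNgt rm.
have [q qE] := mult 1 A1.
have NqE : N%:R = q%:~R * m%:R :> rat.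
  by rewrite -[LHS]mul1r [X in X * _]qE -mulrA divfK.
have q0 : 0 < q.
  have : 0 < (q * m)%:~R :> rat by rewrite rmorphM /= -NqE ltr0n.
  by rewrite ltr0z pmulr_lgt0.
have qn : (`|q|%N)%:R = q%:~R :> rat by rewrite -[in RHS](gtz0_abs q0).
have qr0 : q%:~R != 0 :> rat by rewrite intr_eq0 gt_eqF.
have gen : m%:R / N%:R = (`|q|%N)%:R^-1 :> rat.
  by rewrite qn NqE; field; apply/andP.
exists `|q|%N; first by rewrite absz_gt0 gt_eqF.
move=> x; rewrite -gen; split=> [|[k ->]]; last exact: AMz.
exact: mult.
Qed.

Lemma lattice_index (A B : set rat) (n m : nat) : (0 < n)%N -> (0 < m)%N ->
  (forall x, A x <-> exists k : int, x = k%:~R / n%:R) ->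
  (forall x, B x <-> exists k : int, x = k%:~R / m%:R) ->
  B `<=` A -> exists2 e, n = (e * m)%N & has_index A B e.
Proof.
move=> n0 m0 AE BE BA.
have nr0 : (n%:R : rat) != 0 by rewrite pnatr_eq0 -lt0n.
have mr0 : (m%:R : rat) != 0 by rewrite pnatr_eq0 -lt0n.
have [|k kE] := proj1 (AE m%:R^-1).
  by apply/BA/BE; exists 1; rewrite mul1r.
have nE : n%:R = k%:~R * m%:R :> rat.
  have -> : k%:~R = n%:R / m%:R :> rat by rewrite kE mulrC divfK.
  by rewrite divfK.
have k0 : 0 < k.
  have : 0 < (k * m)%:~R :> rat by rewrite rmorphM /= -nE ltr0n.
  by rewrite ltr0z pmulr_lgt0 // ltz_nat.
have kn : (`|k|%N)%:R = k%:~R :> rat by rewrite -[in RHS](gtz0_abs k0).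
pose e := `|k|%N.
have e0 : (0 < e)%N by rewrite absz_gt0 gt_eqF.
have eE : n = (e * m)%N by apply/eqP; rewrite -(eqr_nat rat) natrM kn nE.
have er0 : (e%:R : rat) != 0 by rewrite pnatr_eq0 -lt0n.
exists e => //; exists (fun i => (i : nat)%:R / n%:R); split.
  by move=> i; apply/AE; exists (i : nat).
have BnE (j : int) : B (j%:~R / n%:R) <-> (e %| j)%Z.
  rewrite BE; split=> [[l lE]|/dvdzP[l ->]].
    apply/dvdzP; exists l; apply/eqP; rewrite -(eqr_int rat) rmorphM /=.
    by rewrite -[j%:~R](divfK nr0) lE eE natrM; apply/eqP; field.
  by exists l; rewrite eE natrM rmorphM /=; field; apply/andP.
move=> g /AE[j ->].
have ez : (e%:Z : int) != 0 by rewrite gt_eqF.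
have je0 : 0 <= (j %% e)%Z by rewrite modz_ge0.
have jlt : (`|(j %% e)%Z| < e)%N by rewrite -ltz_nat gez0_abs // ltz_pmod.
have subE (i : nat) : j%:~R / n%:R - i%:R / n%:R = (j - i%:Z)%:~R / n%:R :> rat.
  by rewrite rmorphB mulrBl.
exists (Ordinal jlt); split=> /=.
  rewrite subE; apply/BnE; rewrite gez0_abs //.
  by rewrite {1}(divz_eq j e) addrK dvdz_mull // dvdzz.
move=> i'; rewrite subE => /BnE; rewrite -eqz_mod_dvd => /eqP ji.
apply: val_inj => /=; rewrite ji modz_small //.
by rewrite ltz_nat ltn_ord.
Qed.

(** * Generated subfields *)

Lemma field_gen_min (K F : fieldType) (iota : {rmorphism K -> F}) (S L : set F) :
  is_subfield L -> range iota `<=` L -> S `<=` L -> field_gen iota S `<=` L.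
Proof. by move=> Lf KL SL x; apply; split=> // y [/KL|/SL]. Qed.

Lemma field_gen_subfield (K F : fieldType) (iota : {rmorphism K -> F}) (S : set F) :
  is_subfield (field_gen iota S).
Proof.
split=> [|x y|x y].
- by apply/mem_set => L [[L1 _ _] _]; apply/set_mem.
- move=> /set_mem hx /set_mem hy; apply/mem_set => L hL; apply/set_mem.
  have [Lf _] := hL; have [_ LB _] := Lf.
  by apply: LB; apply/mem_set; [apply: hx|apply: hy].
- move=> /set_mem hx /set_mem hy; apply/mem_set => L hL; apply/set_mem.
  have [Lf _] := hL; have [_ _ Ld] := Lf.
  by apply: Ld; apply/mem_set; [apply: hx|apply: hy].
Qed.

Lemma field_gen_base (K F : fieldType) (iota : {rmorphism K -> F}) (S : set F) :
  range iota `<=` field_gen iota S.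
Proof. by move=> x Kx L [_]; apply; left. Qed.

Lemma field_gen_sub (K F : fieldType) (iota : {rmorphism K -> F}) (S : set F) :
  S `<=` field_gen iota S.
Proof. by move=> x Sx L [_]; apply; right. Qed.

(** The elements with this property form a subfield. *)
Lemma field_gen_finitary (K F : fieldType) (iota : {rmorphism K -> F})
    (S : set F) x : field_gen iota S x ->
  exists2 s : seq F, (forall y, y \in s -> S y) &
    forall L, is_subfield L -> range iota `<=` L -> (forall y, y \in s -> L y) -> L x.
Proof.
pose T : set F := [set x | exists2 s : seq F, (forall y, y \in s -> S y) &
  forall L, is_subfield L -> range iota `<=` L -> (forall y, y \in s -> L y) -> L x].
move: x; apply: (@field_gen_min _ _ iota S T).
- split=> [|x y|x y].
  + by apply/mem_set; exists [::] => // L [L1 _ _] _ _; apply/set_mem.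
  + move=> /set_mem[s sS sx] /set_mem[s' sS' sy]; apply/mem_set; exists (s ++ s').
      by move=> z; rewrite mem_cat => /orP[/sS|/sS'].
    move=> L Lf KL Ls; have [_ LB _] := Lf; apply/set_mem/LB; apply/mem_set.
      by apply: sx => // z zs; apply: Ls; rewrite mem_cat zs.
    by apply: sy => // z zs; apply: Ls; rewrite mem_cat zs orbT.
  + move=> /set_mem[s sS sx] /set_mem[s' sS' sy]; apply/mem_set; exists (s ++ s').
      by move=> z; rewrite mem_cat => /orP[/sS|/sS'].
    move=> L Lf KL Ls; have [_ _ Ld] := Lf; apply/set_mem/Ld; apply/mem_set.
      by apply: sx => // z zs; apply: Ls; rewrite mem_cat zs.
    by apply: sy => // z zs; apply: Ls; rewrite mem_cat zs orbT.
- by move=> y Ky; exists [::] => // L _ KL _; apply: KL.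
- by move=> y Sy; exists [:: y] => [z|L _ _]; [rewrite inE => /eqP-> | apply; rewrite inE].
Qed.

Section Subfield.

Variables (F : fieldType) (L : set F).
Hypothesis Lf : is_subfield L.

Lemma subfield1 : L 1. Proof. by case: Lf => h _ _; apply/set_mem. Qed.

Lemma subfieldB x y : L x -> L y -> L (x - y).
Proof. by case: Lf => _ h _ /mem_set hx /mem_set hy; apply/set_mem/h. Qed.

Lemma subfield_div x y : L x -> L y -> L (x / y).
Proof. by case: Lf => _ _ h /mem_set hx /mem_set hy; apply/set_mem/h. Qed.

Lemma subfield0 : L 0.
Proof. by rewrite -(subrr 1); apply: subfieldB; exact: subfield1. Qed.

Lemma subfieldN x : L x -> L (- x).
Proof. by move=> Lx; rewrite -sub0r; apply: subfieldB => //; exact: subfield0. Qed.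

Lemma subfieldD x y : L x -> L y -> L (x + y).
Proof. by move=> Lx Ly; rewrite -[y]opprK; apply: subfieldB => //; apply: subfieldN. Qed.

Lemma subfieldM x y : L x -> L y -> L (x * y).
Proof.
move=> Lx Ly; rewrite -[y]invrK; apply: subfield_div => //.
by rewrite -div1r; apply: subfield_div => //; exact: subfield1.
Qed.

Lemma subfieldX x n : L x -> L (x ^+ n).
Proof.
move=> Lx; elim: n => [|n IH]; first exact: subfield1.
by rewrite exprS; apply: subfieldM.
Qed.

Lemma subfield_nat n : L n%:R.
Proof.
elim: n => [|n IH]; first exact: subfield0.
by rewrite -natr1; apply: subfieldD => //; exact: subfield1.
Qed.

Lemma subfield_horner (K : fieldType) (j : {rmorphism K -> F}) (q : {poly K}) z :
  range j `<=` L -> L z -> L (map_poly j q).[z].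
Proof.
move=> KL Lz; elim/poly_ind: q => [|q k IH].
  by rewrite raddf0 horner0; exact: subfield0.
rewrite rmorphD rmorphM /= map_polyX map_polyC /= !hornerE.
by apply: subfieldD; [apply: subfieldM | apply: KL; exists k].
Qed.

End Subfield.

(** * Roots of unity and differences of p-th powers *)

Section RootsOfUnity.

Variables (p : nat) (p_prime : prime p).
Variables (F : closedFieldType) (v : F -> \bar rat).
Hypothesis v_val : is_valuation v.
Hypothesis v_p : v p%:R = 1%:E.

Lemma prime_primitive_root : exists z : F, p.-primitive_root z.
Proof.
have p0 := v_neq0 v_val v_p; have p1 := prime_gt1 p_prime.
pose q : {poly F} := \poly_(i < p) 1.
have qE x : q.[x] = \sum_(i < p) x ^+ i.
  by rewrite horner_poly; apply: eq_bigr => i _; rewrite mul1r.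
have sq : size q = p by rewrite size_poly_eq // oner_neq0.
have /closed_rootP[z /rootP] : size q != 1 by rewrite sq gtn_eqF.
rewrite qE => qz; exists z.
have zp : z ^+ p = 1 by apply/eqP; rewrite -subr_eq0 subrX1 qz mulr0.
have [m mz mp] := prim_order_exists (prime_gt0 p_prime) zp.
case/primeP: p_prime => _ /(_ m mp) /orP[] /eqP mE; last by rewrite -mE.
have := prim_expr_order mz; rewrite mE expr1 => z1.
move: qz; rewrite z1 (eq_bigr (fun=> 1)) => [|i _]; last by rewrite expr1n.
by rewrite sumr_const card_ord => /eqP; rewrite (negbTE p0).
Qed.

Variables (z : F) (z_prim : p.-primitive_root z).

(** The valuation of [1 - z], see [v_1subz]. *)
Definition tau : rat := (p%:R - 1)^-1.

Let p1_gt0 : 0 < (p%:R - 1 : rat).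
Proof. by rewrite subr_gt0 ltr1n prime_gt1. Qed.

Lemma tau_gt0 : 0 < tau.
Proof. by rewrite invr_gt0. Qed.

Lemma tauE : (p%:R - 1) * tau = 1.
Proof. by rewrite mulfV // gt_eqF. Qed.

Lemma v_unity x : x ^+ p = 1 -> v x = 0%:E.
Proof.
move=> xp; have x0 : x != 0.
  by apply/eqP => x0; move/eqP: xp; rewrite x0 expr0n gtn_eqF ?prime_gt0 // eq_sym oner_eq0.
have [s vs] := v_finite v_val x0.
have := vX v_val p vs; rewrite xp (v1 v_val) vs => -[] /esym/eqP.
by rewrite mulf_eq0 pnatr_eq0 gtn_eqF ?prime_gt0 //= => /eqP->.
Qed.

Lemma zX i : (z ^+ i) ^+ p = 1.
Proof. by rewrite exprAC (prim_expr_order z_prim) expr1n. Qed.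

(** Each of [z] and [z ^+ i] is a power of the other, so [1 - z] and [1 - z ^+ i]
divide each other in the ring of integers; and the product of all
[1 - z ^+ i] is [p]. *)
Lemma v_1subz i : (0 < i < p)%N -> v (1 - z ^+ i) = tau%:E.
Proof.
have sub0 (w : F) k : p.-primitive_root w -> (0 < k < p)%N -> 1 - w ^+ k != 0.
  move=> pw /andP[k0 kp]; rewrite subr_eq0 eq_sym -(prim_order_dvd pw).
  by rewrite gtnNdvd.
have le1 w k s : p.-primitive_root w -> vge v s (1 - w) -> vge v s (1 - w ^+ k).
  move=> pw hs.
  have -> : 1 - w ^+ k = (\sum_(i < k) w ^+ i) * (1 - w).
    by rewrite -opprB subrX1; ring.
  apply: (vgeM0 v_val) => //; apply: (vge_sum v_val) => k' _.
  apply/(vge_eq _ (vX v_val k' (v_unity (prim_expr_order pw)))).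
  by rewrite mulr0.
have p1 := prime_gt1 p_prime.
have [t vt] : exists t, v (1 - z) = t%:E.
  by apply: (v_finite v_val); rewrite -[z]expr1 sub0.
have all_eq k : (0 < k < p)%N -> v (1 - z ^+ k) = t%:E.
  move=> kp; have [s vs] := v_finite v_val (sub0 _ _ z_prim kp).
  have zk_prim : p.-primitive_root (z ^+ k).
    rewrite prim_root_exp_coprime // coprime_sym prime_coprime //.
    by case/andP: kp => k0 kp; rewrite gtnNdvd.
  have /(vge_eq _ vs) ts := le1 z k t z_prim (proj2 (vge_eq _ vt) (lexx t)).
  have [k' k'E] := prim_rootP zk_prim (prim_expr_order z_prim).
  have := le1 _ k' s zk_prim (proj2 (vge_eq _ vs) (lexx s)).
  rewrite -k'E => /(vge_eq _ vt) st.
  by rewrite vs (le_anti (introT andP (conj ts st))).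
move=> /all_eq ->; congr (_%:E).
have prodE : \prod_(1 <= i < p) (1 - z ^+ i) = p%:R.
  have X1 : ('X - 1%:P : {poly F}) != 0 by rewrite polyXsubC_eq0.
  have E : \prod_(1 <= i < p) ('X - (z ^+ i)%:P) = \sum_(i < p) 'X^i.
    apply: (mulfI X1); rewrite polyC1 -subrX1 -(factor_Xn_sub_1 z_prim).
    by rewrite [RHS]big_ltn ?prime_gt0 // expr0 polyC1.
  have := congr1 (fun q : {poly F} => q.[1]) E.
  rewrite horner_prod horner_sum (eq_bigr (fun i => 1 - z ^+ i)) => [->|k _].
    rewrite (eq_bigr (fun=> 1)) => [|k _]; last by rewrite hornerXn expr1n.
    by rewrite sumr_const card_ord.
  by rewrite !hornerE.
have : v (\prod_(1 <= i < p) (1 - z ^+ i)) = ((p%:R - 1) * t)%:E.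
  rewrite big_nat_cond (eq_bigr (fun i => if (0 < i < p)%N then 1 - z ^+ i else 1 - z)).
    rewrite -big_nat_cond (v_prod_const v_val _ (s := t)); last first.
      by move=> k; case: ifP => // /all_eq.
    by rewrite size_iota natrB // prime_gt0.
  by move=> k /andP[-> _].
rewrite prodE v_p => -[] E; apply: (mulfI (lt0r_neq0 p1_gt0)).
by rewrite -E tauE.
Qed.

Lemma v_zsubz i j : (i < p)%N -> (j < p)%N -> i != j -> v (z ^+ i - z ^+ j) = tau%:E.
Proof.
wlog ij : i j / (i < j)%N.
  move=> hw ip jp ne; case: (ltngtP i j) => [h|h|h]; first exact: hw.
    by rewrite -opprB (vN v_val); apply: hw => //; rewrite eq_sym.
  by rewrite h eqxx in ne.
move=> ip jp _; have -> : z ^+ i - z ^+ j = z ^+ i * (1 - z ^+ (j - i)).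
  by rewrite mulrBr mulr1 -exprD subnKC // ltnW.
have h : (0 < j - i < p)%N by rewrite subn_gt0 ij (leq_ltn_trans (leq_subr _ _)).
by rewrite (vM v_val (v_unity (zX i)) (v_1subz h)) add0r.
Qed.

Lemma subX_prod x y : x ^+ p - y ^+ p = \prod_(i < p) (x - z ^+ i * y).
Proof.
have [->|y0] := eqVneq y 0.
  rewrite expr0n gtn_eqF ?prime_gt0 // subr0.
  rewrite (eq_bigr (fun=> x)) => [|i _]; last by rewrite mulr0 subr0.
  by rewrite prodr_const card_ord.
have := congr1 (fun q : {poly F} => q.[x / y]) (factor_Xn_sub_1 z_prim).
rewrite horner_prod big_mkord !hornerE => E.
have -> : x ^+ p - y ^+ p = y ^+ p * ((x / y) ^+ p - 1).
  by rewrite expr_div_n; field; apply: expf_neq0.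
rewrite -E -{1}(card_ord p) -prodr_const -big_split; apply: eq_bigr => i _ /=.
by rewrite !hornerE; field.
Qed.

(** The factors of [x ^+ p - y ^+ p] differ from each other by elements of
valuation [v y + tau], so that below this threshold they all have the same valuation. *)
Section Differences.

Variables (x y : F) (t : rat).
Hypothesis vy : v y = t%:E.

Lemma factors_eq (i j : 'I_p) u : v (x - z ^+ i * y) = u%:E -> u < t + tau ->
  v (x - z ^+ j * y) = u%:E.
Proof.
move=> vi ut; have [->//|ij] := eqVneq j i.
have -> : x - z ^+ j * y = (x - z ^+ i * y) + (z ^+ i - z ^+ j) * y by ring.
apply: (vDl v_val vi ut); have ij' : (i : nat) != j by rewrite eq_sym.
apply/(vge_eq _ (vM v_val (v_zsubz (ltn_ord i) (ltn_ord j) ij') vy)).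
by rewrite addrC.
Qed.

Lemma subX_v (i : 'I_p) u : v (x - z ^+ i * y) = u%:E -> u < t + tau ->
  v (x ^+ p - y ^+ p) = (p%:R * u)%:E.
Proof.
move=> vi ut; rewrite subX_prod (v_prod_const v_val _ (s := u)).
  by rewrite /index_enum -enumT size_enum_ord.
by move=> j; apply: factors_eq vi ut.
Qed.

Lemma subX_vge_low s (i : 'I_p) : s <= t + tau -> vge v (p%:R * s) (x ^+ p - y ^+ p) ->
  vge v s (x - z ^+ i * y).
Proof.
move=> st h; have [//|[u vi us]] := vgeP v_val s (x - z ^+ i * y).
move: h; rewrite (vge_eq _ (subX_v vi (lt_le_trans us st))).
by rewrite ler_pM2l ?ltr0n ?prime_gt0 // leNgt us.
Qed.

Lemma subX_v_low s (i : 'I_p) : s < p%:R * (t + tau) -> v (x ^+ p - y ^+ p) = s%:E ->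
  v (x - z ^+ i * y) = (s / p%:R)%:E.
Proof.
have p0 : (0 : rat) < p%:R by rewrite ltr0n prime_gt0.
move=> st vs; have [k [u vk ut]] : exists k : 'I_p, exists2 u,
    v (x - z ^+ k * y) = u%:E & u < t + tau.
  apply: contrapT => no.
  have all (k : 'I_p) : vge v (t + tau) (x - z ^+ k * y).
    by have [//|[u vk ut]] := vgeP v_val (t + tau) (x - z ^+ k * y); case: no; exists k, u.
  have := @vge_prod _ _ v_val _ (index_enum 'I_p) _ _ all.
  rewrite -subX_prod (vge_eq _ vs).
  by rewrite /index_enum -enumT size_enum_ord leNgt st.
rewrite (factors_eq i vk ut); congr (_%:E).
by have := subX_v vk ut; rewrite vs => -[] ->; rewrite mulrC mulKf // gt_eqF.
Qed.

(** If all factors had valuation exactly [t + tau], or all a common smaller one,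
the product would have valuation at most [p * (t + tau)]. *)
Lemma subX_vge_high r : p%:R * (t + tau) < r -> vge v r (x ^+ p - y ^+ p) ->
  exists (i : 'I_p) s, t + tau < s /\ vge v s (x - z ^+ i * y).
Proof.
move=> tr hr; apply: contrapT => no.
have all (k : 'I_p) : v (x - z ^+ k * y) = (t + tau)%:E.
  have [|[u vk ut]] := vgeP v_val (t + tau + 1) (x - z ^+ k * y).
    by move=> h; case: no; exists k, (t + tau + 1); split=> //; lra.
  rewrite vk; congr (_%:E); apply/eqP; rewrite eq_le; apply/andP; split.
    rewrite leNgt; apply/negP => h; apply: no; exists k, u; split=> //.
    by apply/(vge_eq _ vk).
  rewrite leNgt; apply/negP => h; move: hr; rewrite (vge_eq _ (subX_v vk h)).
  rewrite leNgt; apply/negP; rewrite negbK; apply: lt_trans tr.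
  by rewrite ltr_pM2l // ltr0n prime_gt0.
have := v_prod_const v_val (index_enum 'I_p) all.
rewrite -subX_prod /index_enum -enumT size_enum_ord => vs.
by move: hr; rewrite (vge_eq _ vs) leNgt tr.
Qed.

(** The factor of least valuation: this valuation is at most the average
[s / p], and it is positive since a nonpositive one, being below the
threshold, would be common to all the factors. *)
Lemma subX_v_small s : 0 < t + tau -> 0 < s -> v (x ^+ p - y ^+ p) = s%:E ->
  exists (i : 'I_p) u, v (x - z ^+ i * y) = u%:E /\ 0 < u <= s / p%:R.
Proof.
have p0 : (0 : rat) < p%:R by rewrite ltr0n prime_gt0.
move=> t0 s0 vs.
have /choice[u vu] : forall i : 'I_p, exists u, v (x - z ^+ i * y) = u%:E.
  move=> i; apply: (v_finite v_val); have := v_neq0 v_val vs.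
  by rewrite subX_prod => /prodf_neq0; apply.
have [i _ mi] := @arg_minP _ _ _ (Ordinal (prime_gt0 p_prime)) predT u erefl.
exists i, (u i); split=> //; apply/andP; split.
  rewrite ltNge; apply/negP => ui.
  have := subX_v (vu i) (le_lt_trans ui t0); rewrite vs => -[] sE.
  by move: s0; rewrite sE pmulr_rgt0 // ltNge ui.
have all (k : 'I_p) : vge v (u i) (x - z ^+ k * y).
  by apply/(vge_eq _ (vu k)); apply: mi.
have := @vge_prod _ _ v_val _ (index_enum 'I_p) _ _ all.
rewrite -subX_prod (vge_eq _ vs) /index_enum -enumT size_enum_ord.
by rewrite ler_pdivlMr // mulrC.
Qed.

End Differences.

Lemma pth_roots x y : x ^+ p = y ^+ p -> exists i : 'I_p, x = z ^+ i * y.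
Proof.
move=> xy; have /eqP : x ^+ p - y ^+ p = 0 by rewrite xy subrr.
rewrite subX_prod => /prodf_eq0[i _ /eqP xi]; exists i.
by apply/eqP; rewrite -subr_eq0 xi.
Qed.

Lemma XnsubC_prod y : y != 0 -> exists2 s : seq F, uniq s &
  'X^p - (y ^+ p)%:P = \prod_(u <- s) ('X - u%:P).
Proof.
move=> y0; pose s := [seq z ^+ i * y | i <- iota 0 p].
have us : uniq s.
  rewrite map_inj_in_uniq ?iota_uniq // => i j; rewrite !mem_iota /= !add0n => ip jp.
  move=> /(mulIf y0) E; apply/eqP/negPn/negP => ij.
  by have := v_zsubz ip jp ij; rewrite E subrr (v0 v_val).
exists s => //.
rewrite [LHS](@all_roots_prod_XsubC _ _ s) ?uniq_rootsE //.
- by rewrite (monicP (monicXnsubC _ (prime_gt0 p_prime))) scale1r.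
- by rewrite size_XnsubC ?prime_gt0 // size_map size_iota.
apply/allP => u /mapP[i _ ->]; rewrite rootE !hornerE.
by rewrite exprMn zX mul1r subrr.
Qed.
End RootsOfUnity.

(** * The iterated extension *)

Lemma exp_small (p : nat) (x y : rat) : (1 < p)%N -> 0 < y ->
  exists n : nat, x / p%:R ^+ n < y.
Proof.
move=> p1 y0; exists (Num.Def.archi_bound `|x / y|).
set n := Num.Def.archi_bound _.
have pn0 : 0 < p%:R ^+ n :> rat by rewrite exprn_gt0 // ltr0n ltnW.
rewrite ltr_pdivrMr // mulrC -ltr_pdivrMr //.
apply: le_lt_trans (ler_norm _) _; apply: lt_le_trans (archi_boundP (normr_ge0 _)) _.
by rewrite -/n -natrX ler_nat ltnW // ltn_expl.
Qed.

(** A polynomial whose values at sufficiently many points in different residue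
classes are small has small coefficients: peel off one point at a time, as in
Newton's interpolation formula. *)
Lemma interpolation_bound (F : fieldType) (v : F -> \bar rat) (s : seq F)
    (r : {poly F}) t : is_valuation v -> (size r <= size s)%N -> uniq s ->
  (forall x, x \in s -> vge v 0 x) ->
  (forall x y, x \in s -> y \in s -> x != y -> v (x - y) = 0%:E) ->
  (forall x, x \in s -> vge v t r.[x]) -> forall i, vge v t r`_i.
Proof.
move=> v_val; elim: s r => [|x s IH] r.
  by rewrite leqn0 size_poly_eq0 => /eqP-> _ _ _ _ i; rewrite coef0; apply: vge0.
move=> sr /andP[xs us] s_int sv rv.
have xin : x \in x :: s by rewrite mem_head.
have /factor_theorem[q qE] : root (r - (r.[x])%:P) x.
  by rewrite rootE !hornerE subrr.
have rE : r = q * ('X - x%:P) + (r.[x])%:P by rewrite -qE subrK.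
have q_small i : vge v t q`_i.
  apply: IH => // [|y ys|y y' ys ys'|y ys].
  - have [->|q0] := eqVneq q 0; first by rewrite size_poly0.
    have := size_Mmonic q0 (monicXsubC x); rewrite size_XsubC addn2 /= -qE => sq.
    rewrite -ltnS -sq; apply: leq_trans (size_polyD _ _) _.
    rewrite size_polyN geq_max sr /=; apply: leq_trans (size_polyC_leq1 _) _.
    by [].
  - by apply: s_int; rewrite inE ys orbT.
  - by apply: sv; rewrite inE ?ys ?ys' orbT.
  have yin : y \in x :: s by rewrite inE ys orbT.
  have yx : y != x by apply: contraNneq xs => <-.
  have vyx := sv _ _ yin xin yx; have yx0 := v_neq0 v_val vyx.
  have -> : q.[y] = (r.[y] - r.[x]) / (y - x).
    by rewrite [in r.[y]]rE !hornerE addrK mulfK.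
  rewrite -[t]addr0; apply: (vgeM v_val).
    by apply: (vgeB v_val); apply: rv.
  by apply/(vge_eq _ (vV v_val vyx)); rewrite oppr0.
move=> i; rewrite rE mulrBr coefD coefB coefMX coefMC coefC.
apply: (vgeD v_val); last by case: eqP => _; [apply: rv | apply: vge0].
apply: (vgeB v_val); first by case: eqP => _; [apply: vge0 | ].
by rewrite mulrC; apply: (vgeM0 v_val) => //; apply: s_int.
Qed.

(** Among [e + 1] multiples of a value, two are in the same class. *)
Lemma finite_index_denominator (A B : set rat) (e N : nat) : (0 < N)%N ->
  A 0 -> (forall x y, A x -> A y -> A (x + y)) ->
  (forall x y, B x -> B y -> B (x - y)) ->
  (forall x, B x -> exists k : int, N%:R * x = k%:~R) -> has_index A B e ->
  forall x, A x -> exists k : int, (e`! * N)%:R * x = k%:~R.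
Proof.
move=> N0 A0 AD BB Bden [r [_ hr]] x Ax.
have Am n : A (n%:R * x).
  elim: n => [|n IH]; first by rewrite mul0r.
  by rewrite -natr1 mulrDl mul1r; apply: AD.
have /choice[cl hcl] : forall n : 'I_e.+1, exists i : 'I_e, B ((n : nat)%:R * x - r i).
  by move=> n; have [i [hi _]] := hr _ (Am n); exists i.
have /injectivePn[i [j ij clij]] : ~~ injectiveb cl.
  apply/negP => /injectiveP/leq_card; rewrite !card_ord ltnn //.
wlog lt_ij : i j ij clij / (i < j)%N.
  move=> hw; case: (ltngtP i j) => [h|h|/val_inj h].
  - exact: (hw i j).
  - by apply: (hw j i) => //; rewrite eq_sym.
  - by rewrite h eqxx in ij.
have [k kE] : exists k : int, N%:R * ((j - i)%N%:R * x) = k%:~R.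
  apply: Bden; rewrite natrB ?(ltnW lt_ij) // mulrBl.
  have -> : j%:R * x - i%:R * x = (j%:R * x - r (cl j)) - (i%:R * x - r (cl i)).
    by rewrite clij; ring.
  exact: BB.
have /dvdn_fact/dvdnP[w ->] : (0 < j - i <= e)%N.
  by rewrite subn_gt0 lt_ij /= leq_subLR (leq_trans _ (leq_addl _ _)) // -ltnS.
exists (w%:Z * k); rewrite intrM -kE !natrM -pmulrn; ring.
Qed.

Section Dynamics.

Variables (p : nat) (p_prime : prime p).
Variables (Qp : fieldType) (vp : Qp -> \bar rat).
Hypothesis hQp : is_padic_numbers p vp.
Variables (K : fieldExtType Qp) (F : closedFieldType) (iota : {rmorphism K -> F}).
Hypothesis F_alg : forall x : F, algebraicOver iota x.
Variable (v : F -> \bar rat).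
Hypothesis v_val : is_valuation v.
Hypothesis v_ext : forall x : Qp, v (iota x%:A) = vp x.
Variables (c a : K).
Hypothesis c_neq0 : c != 0.

Let f : {poly F} := 'X^p - (iota c)%:P.
Let Kinf := K_infty iota f (iota a).

Definition base_emb : {rmorphism Qp -> F} := iota \o GRing.in_alg K.

Let j0 := base_emb.

Let j0_v x : v (j0 x) = vp x := v_ext x.

(** The algebraic closure of [K] is algebraic over the p-adic numbers since [K]
is: the coefficients of an equation over [K] are integral. *)
Lemma algebraic_base x : algebraicOver j0 x.
Proof.
apply/integral_algebraic.
have /integral_algebraic[q qm qx] := F_alg x.
apply: (@integral_root_monic _ _ j0 x (map_poly iota q)) => //.
  by rewrite monic_map.
move=> y /(nthP 0)[i]; rewrite size_map_poly => iq <-; rewrite coef_map.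
have [r rE] : exists r : {poly Qp}, minPoly 1%VS q`_i = map_poly (GRing.in_alg K) r.
  by apply/polyOver1P; apply: minPolyOver.
exists r; first by rewrite -(map_monic (GRing.in_alg K)) -rE monic_minPoly.
rewrite map_poly_comp -rE fmorph_root; exact: root_minPoly.
Qed.

Definition base_ext : local_ext j0 := @LocalExt Qp F j0 K iota (fun x => erefl).

Let v_p : v p%:R = 1%:E.
Proof. by rewrite -(vp_p p_prime hQp) -j0_v rmorph_nat. Qed.

Lemma finite_ext_local (E : local_ext j0) (L : set F) :
  is_subfield L -> range iota `<=` L -> L `<=` im E -> finite_ext iota L.
Proof.
move=> Lf KL LE.
have [|x y|y x|n [b [bL bE]]] := subspace_generated LE.
- exact: subfield0.
- exact: subfieldD.
- by move=> Lx; apply: subfieldM => //; apply: KL; exists (y%:A).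
exists n, b; split=> // x /bE[y ->]; exists (fun i => (y i)%:A).
by apply: eq_bigr.
Qed.

Lemma adjoin_seq (E : local_ext j0) (s : seq F) : exists E' : local_ext j0,
  [/\ im E `<=` im E', forall y, y \in s -> im E' y &
      forall M, is_subfield M -> im E `<=` M -> (forall y, y \in s -> M y) ->
        im E' `<=` M].
Proof.
elim: s => [|x s [E1 [EE1 sE1 minE1]]]; first by exists E; split.
have [P [E2 [_ [E12 xE2 E2E]]]] := adjoin algebraic_base E1 x.
exists E2; split.
- by move=> y /EE1/E12.
- by move=> y; rewrite inE => /predU1P[->|/sE1/E12].
move=> M Mf EM sM y /E2E[q ->]; apply: subfield_horner => //.
  by apply: minE1 => // u us; apply: sM; rewrite inE us orbT.
by apply: sM; rewrite mem_head.
Qed.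

Lemma finite_ext_in_local (L : set F) : finite_ext iota L ->
  exists E : local_ext j0, L `<=` im E.
Proof.
move=> [n [b [_ Lb]]].
have [E [KE bE _]] := adjoin_seq base_ext [seq b i | i <- enum 'I_n].
have Ef := im_subfield E.
exists E => x /Lb[k ->]; apply: (@big_ind _ (im E)) => [|x1 x2|i _].
- exact: subfield0.
- exact: subfieldD.
apply: subfieldM => //; first by apply: KE; exists (k i).
by apply: bE; apply: map_f; rewrite mem_enum.
Qed.

(** With bounded denominators a value group is the group of multiples of some
[1 / n], so that ramification indices are quotients of two such [n]. *)
Lemma value_lattice (L : set F) (N : nat) : is_subfield L -> (0 < N)%N ->
  (forall x s, L x -> v x = s%:E -> exists k : int, N%:R * s = k%:~R) ->
  exists2 n : nat, (0 < n)%N &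
    forall s, value_group v L s <-> exists k : int, s = k%:~R / n%:R.
Proof.
move=> Lf N0 hN; apply: (@discrete_subgroup _ N) => //.
- by exists p%:R; [apply: subfield_nat | exact: v_p].
- move=> s t [x Lx vx] [y Ly vy]; exists (x / y); first exact: subfield_div.
  exact: v_div.
- by move=> s [x Lx vx]; apply: hN vx.
Qed.

Lemma local_lattice (E : local_ext j0) (L : set F) : is_subfield L -> L `<=` im E ->
  exists2 n : nat, (0 < n)%N &
    forall s, value_group v L s <-> exists k : int, s = k%:~R / n%:R.
Proof.
move=> Lf LE; have [N N0 hN] := value_denominator hQp v_val j0_v E.
by apply: (value_lattice Lf N0) => x s /LE; apply: hN.
Qed.

(** * The backward orbit of the base point *)

Definition step (z : F) : F := z ^+ p - iota c.

Definition level n : set F := [set z | iter n step z = iota a].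

Lemma horner_step z : f.[z] = step z.
Proof. by rewrite !hornerE. Qed.

Lemma level_solutions n z : solutions f n (iota a) z <-> level n z.
Proof.
rewrite /solutions /level /=.
have -> : root (poly_iter f n - (iota a)%:P) z = (iter n step z == iota a).
  rewrite rootE !hornerE subr_eq0; congr (_ == _).
  elim: n => [|n IH]; first by rewrite hornerX.
  by rewrite /= horner_comp horner_step -/(poly_iter f n) IH.
by split=> [/eqP|/eqP].
Qed.

Lemma level_step n z : level n.+1 z <-> level n (step z).
Proof. by rewrite /level /= -iterS iterSr. Qed.

Lemma step_eq z w : z ^+ p = w + iota c -> step z = w.
Proof. by rewrite /step => ->; rewrite addrK. Qed.

Lemma preimage w : exists z, z ^+ p = w + iota c.
Proof.
have /closed_rootP[z] : size ('X^p - (w + iota c)%:P) != 1.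
  by rewrite size_XnsubC ?prime_gt0 // eqSS -lt0n prime_gt0.
by rewrite rootE !hornerE subr_eq0 => /eqP zp; exists z.
Qed.

Lemma level_Kinf n z : level n z -> Kinf z.
Proof. by move/level_solutions => nz; apply: field_gen_sub; exists n. Qed.

Lemma Kinf_min L : is_subfield L -> range iota `<=` L ->
  (forall n z, level n z -> L z) -> Kinf `<=` L.
Proof.
move=> Lf KL sL; apply: field_gen_min => // z [n _ nz].
by apply: (sL n); apply/level_solutions.
Qed.

Let Kinf_subfield : is_subfield Kinf := field_gen_subfield _ _.
Let K_Kinf : range iota `<=` Kinf := @field_gen_base _ _ _ _.

Let ic_neq0 : iota c != 0. Proof. by rewrite fmorph_eq0. Qed.

Let p0 : (0 : rat) < p%:R. Proof. by rewrite ltr0n prime_gt0. Qed.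

Let p_ge1 : (1 : rat) <= p%:R. Proof. by rewrite ler1n prime_gt0. Qed.

Lemma vge_root r x : vge v (p%:R * r) (x ^+ p) -> vge v r x.
Proof.
move=> h; have [//|[u vu ur]] := vgeP v_val r x.
by move: h; rewrite (vge_eq _ (vX v_val p vu)) ler_pM2l // leNgt ur.
Qed.

Variables (zeta : F) (zeta_prim : p.-primitive_root zeta).

Let tau_gt0 := tau_gt0 p_prime.

(** * Infinite wild ramification *)

Section WildRamification.

Variables (vc : rat).
Hypothesis v_c : v (iota c) = vc%:E.
Hypothesis vc_gt : - (p%:R * tau p) < vc.

(* Chosen between [- v c / p] and [tau]: the first bound makes the condition
   [v z >= - mu] stable under preimages, the second makes the threshold
   [v z + tau] positive. *)
Let mu := Num.max (- vc / p%:R) (tau p / 2%:R).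

Let mu_gt0 : 0 < mu.
Proof. by rewrite lt_max; apply/orP; right; apply: divr_gt0. Qed.

Let mu_lt : mu < tau p.
Proof.
rewrite gt_max; apply/andP; split; last by move: tau_gt0; lra.
by rewrite ltr_pdivrMr // mulrC ltrNl.
Qed.

Let mu_c : - (p%:R * mu) <= vc.
Proof.
rewrite lerNl -ler_pdivrMl // mulrC; by rewrite le_max lexx.
Qed.

Let near_orbit : set F := [set z | (exists n, level n z) /\ vge v (- mu) z].

Lemma near_orbit_preimage w z : near_orbit w -> z ^+ p = w + iota c -> near_orbit z.
Proof.
move=> [[n wn] wmu] zw; split.
  by exists n.+1; apply/level_step; rewrite (step_eq zw).
apply: vge_root; rewrite zw mulrN; apply: (vgeD v_val).
  apply: vge_le wmu; by rewrite lerN2 (ler_peMl (ltW mu_gt0)).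
by apply/(vge_eq _ v_c).
Qed.

(** Under repeated preimages, a lower bound [- la] on the valuation becomes
[- la / p ^ n], until the constant term takes over. *)
Lemma near_orbit_inhabited : exists z, near_orbit z.
Proof.
have [la hla] : exists la, vge v (- la) (iota a).
  have [|[s vs _]] := vgeP v_val 0 (iota a); first by exists 0; rewrite oppr0.
  by exists (- s); rewrite opprK; apply/(vge_eq _ vs).
have reach n : exists z, level n z /\
    vge v (- Num.max (la / p%:R ^+ n) mu) z.
  elim: n => [|n [w [wn hw]]].
    exists (iota a); split=> //; apply: vge_le hla.
    by rewrite expr0 divr1 lerN2 le_max lexx.
  have [z zw] := preimage w; exists z; split.
    by apply/level_step; rewrite (step_eq zw).
  apply: vge_root; rewrite zw mulrN maxr_pMr ?ltW //.
  have -> : p%:R * (la / p%:R ^+ n.+1) = la / p%:R ^+ n.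
    have pn : p%:R ^+ n != 0 :> rat by rewrite expf_neq0 // gt_eqF.
    by rewrite exprS; field; apply/andP; split => //; rewrite gt_eqF.
  have mup : mu <= p%:R * mu by rewrite (ler_peMl (ltW mu_gt0)).
  apply: (vgeD v_val).
    by apply: vge_le hw; rewrite lerN2 ge_max !le_max lexx mup !orbT.
  apply: (@vge_le _ _ _ vc); last by apply/(vge_eq _ v_c).
  by apply: le_trans mu_c; rewrite lerN2 le_max lexx orbT.
have [n hn] := exp_small la (prime_gt1 p_prime) mu_gt0.
have [z [zn hz]] := reach n; exists z; split; first by exists n.
by apply: vge_le hz; rewrite lerN2 ge_max lexx ltW.
Qed.

(** Among the differences between a preimage of [x] and the preimages of [y],
the least valuation is positive and at most [s / p] ([subX_v_small]); below the
threshold all of them are equal to [s / p] ([subX_v_low]). *)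
Lemma pullback_pair x y s : near_orbit x -> near_orbit y -> v (x - y) = s%:E -> 0 < s ->
  exists X Y u, [/\ near_orbit X, near_orbit Y, v (X - Y) = u%:E & 0 < u <= s / p%:R /\
    (s < p%:R * (tau p - mu) -> u = s / p%:R)].
Proof.
move=> Tx Ty vs s0; have [X Xx] := preimage x; have [Y Yy] := preimage y.
have TX := near_orbit_preimage Tx Xx; have TY := near_orbit_preimage Ty Yy.
have XY : v (X ^+ p - Y ^+ p) = s%:E by rewrite Xx Yy -vs; congr (v _); ring.
have sp0 : 0 < s / p%:R by rewrite divr_gt0.
have [Y0|/(v_finite v_val)[t vY]] := eqVneq Y 0.
  exists X, Y, (s / p%:R); rewrite Y0 subr0 sp0 lexx; split=> //; first by rewrite -Y0.
  have X0 : X != 0.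
    have := v_neq0 v_val XY; rewrite Y0 expr0n gtn_eqF ?prime_gt0 // subr0.
    by rewrite expf_eq0 negb_and prime_gt0.
  have [u vu] := v_finite v_val X0; rewrite vu; congr (_%:E).
  move: XY; rewrite Y0 expr0n gtn_eqF ?prime_gt0 // subr0 (vX v_val p vu) => -[] <-.
  by rewrite mulrC mulKf // gt_eqF.
have tmu : - mu <= t by apply/(vge_eq _ vY); case: TY.
have tt0 : 0 < t + tau p by move: mu_lt; lra.
have [i [u [vu /andP[u0 us]]]] := subX_v_small p_prime v_val v_p zeta_prim vY tt0 s0 XY.
exists X, (zeta ^+ i * Y), u; split=> //; last first.
  split; first by rewrite u0.
  move=> hs; have hs' : s < p%:R * (t + tau p).
    by apply: lt_le_trans hs _; rewrite ler_pM2l //; move: tmu; lra.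
  by have := subX_v_low p_prime v_val v_p zeta_prim vY i hs' XY; rewrite vu => -[].
apply: (near_orbit_preimage Ty); rewrite exprMn -Yy exprAC (prim_expr_order zeta_prim).
by rewrite expr1n mul1r.
Qed.

(** Start with the siblings [z] and [zeta * z], pull back until the valuation of
the difference is below the threshold, then keep pulling back. *)
Lemma pair_geometric : exists2 s, 0 < s & forall n, exists x y,
  [/\ near_orbit x, near_orbit y & v (x - y) = (s / p%:R ^+ n)%:E].
Proof.
have pn0 n : 0 < p%:R ^+ n :> rat by rewrite exprn_gt0.
(* Only a preimage of [- c] can vanish, and then its own preimages, the
   [p]-th roots of [c], do not. *)
have [w [z [Tw zw z0]]] : exists w z, [/\ near_orbit w, z ^+ p = w + iota c & z != 0].
  have [w Tw] := near_orbit_inhabited; have [z zw] := preimage w.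
  have [z0|z0] := eqVneq z 0; last by exists w, z.
  have [y yz] := preimage z; exists z, y; split=> //; first exact: near_orbit_preimage zw.
  apply/eqP => y0; move/eqP: yz.
  by rewrite z0 y0 expr0n gtn_eqF ?prime_gt0 // add0r eq_sym (negbTE ic_neq0).
have Tz := near_orbit_preimage Tw zw.
have Tzz : near_orbit (zeta ^+ 1 * z).
  apply: (near_orbit_preimage Tw); rewrite exprMn -zw exprAC (prim_expr_order zeta_prim).
  by rewrite expr1n mul1r.
have [t vz] := v_finite v_val z0.
have tmu : - mu <= t by apply/(vge_eq _ vz); case: Tz.
have v0 : v (z - zeta ^+ 1 * z) = (tau p + t)%:E.
  have -> : z - zeta ^+ 1 * z = (zeta ^+ 0 - zeta ^+ 1) * z by rewrite expr0; ring.
  apply: (vM v_val) => //.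
  by rewrite (v_zsubz p_prime v_val v_p zeta_prim) ?prime_gt0 ?prime_gt1.
have s0 : 0 < tau p + t by move: mu_lt; lra.
pose thr := p%:R * (tau p - mu).
have thr0 : 0 < thr by rewrite mulr_gt0 // subr_gt0.
have [s [s_gt0 s_lt [x [y [Tx Ty vxy]]]]] : exists s, [/\ 0 < s, s < thr &
    exists x y, [/\ near_orbit x, near_orbit y & v (x - y) = s%:E]].
  have reach n : exists x y s, [/\ near_orbit x, near_orbit y, v (x - y) = s%:E &
      0 < s <= (tau p + t) / p%:R ^+ n].
    elim: n => [|n [x [y [s [Tx Ty vs /andP[sg sl]]]]]].
      by exists z, (zeta ^+ 1 * z), (tau p + t); split=> //; rewrite expr0 divr1 s0 lexx.
    have [X [Y [u [TX TY vu [/andP[u0 us] _]]]]] := pullback_pair Tx Ty vs sg.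
    exists X, Y, u; split=> //; rewrite u0; apply: le_trans us _.
    by rewrite exprSr invfM mulrA ler_pM2r ?invr_gt0.
  have [n hn] := exp_small (tau p + t) (prime_gt1 p_prime) thr0.
  have [x [y [s [Tx Ty vs /andP[sg sl]]]]] := reach n.
  by exists s; split=> //; [apply: le_lt_trans hn | exists x, y].
exists s => // n; elim: n => [|n [X [Y [TX TY vXY]]]].
  by exists x, y; rewrite expr0 divr1.
have sn0 : 0 < s / p%:R ^+ n by rewrite divr_gt0.
have [X' [Y' [u [TX' TY' vu [_ uE]]]]] := pullback_pair TX TY vXY sn0.
exists X', Y'; split=> //; rewrite vu uE ?exprSr ?invfM ?mulrA //.
apply: le_lt_trans s_lt; rewrite ler_pdivrMr // (ler_peMr (ltW s_gt0)) //.
by rewrite -natrX ler1n expn_gt0 prime_gt0.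
Qed.

Lemma infinitely_wild : infinitely_wildly_ramified p iota v Kinf.
Proof.
move=> m; have [s s0 hs] := pair_geometric.
have [nK nK0 KE] := local_lattice (im_subfield base_ext) (@subset_refl _ _).
pose N := `|numq s|%N; pose D := `|denq s|%N.
have N0 : (0 < N)%N by rewrite absz_gt0 numq_eq0 gt_eqF.
have D0 : (0 < D)%N by rewrite absz_gt0 denq_neq0.
have sE : s = N%:R / D%:R.
  rewrite -[LHS]divq_num_den; congr (_ / _).
    have : 0 <= numq s by rewrite numq_ge0 ltW.
    by move/gez0_abs => h; rewrite -[in LHS]h.
  by have /gtz0_abs h := denq_gt0 s; rewrite -[in LHS]h.
(* The powers of [p] in the numerator of [s] and in the ramification of [K]
   over the p-adic numbers are to be discounted. *)
pose n := (m + logn p N + logn p nK)%N.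
have [x [y [[[n1 x1] _] [[n2 y2] _] vxy]]] := hs n.
have [E [KE' sE' minE]] := adjoin_seq base_ext [:: x; y].
have EK : im E `<=` Kinf.
  apply: minE => // w; rewrite !inE => /orP[] /eqP->; [exact: level_Kinf x1|exact: level_Kinf y2].
have [nL nL0 LE] := local_lattice (im_subfield E) (@subset_refl _ _).
have BA : value_group v (im base_ext) `<=` value_group v (im E).
  by move=> g [w Kw vw]; exists w => //; apply: KE'.
have [e eE ind] := lattice_index nL0 nK0 LE KE BA.
exists (im E), e; split=> //.
  split=> //; first exact: im_subfield.
  by apply: (@finite_ext_local E) => //; apply: im_subfield.
have [k kE] : exists k : int, s / p%:R ^+ n = k%:~R / nL%:R.
  apply/LE; exists (x - y) => //; apply: subfieldB; first exact: im_subfield.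
    by apply: sE'; rewrite mem_head.
  by apply: sE'; rewrite !inE eqxx orbT.
have pn0 : p%:R ^+ n != 0 :> rat by rewrite expf_neq0 // gt_eqF.
have nLr0 : nL%:R != 0 :> rat by rewrite pnatr_eq0 -lt0n.
have Dr0 : D%:R != 0 :> rat by rewrite pnatr_eq0 -lt0n.
have int_eq : ((N * nL)%N : int) = k * (p ^ n * D)%N.
  apply/eqP; rewrite -(eqr_int rat) intrM -!pmulrn !natrM natrX.
  have -> : N%:R = s * D%:R by rewrite sE divfK.
  have -> : s = k%:~R / nL%:R * p%:R ^+ n by rewrite -kE divfK.
  by apply/eqP; field.
have div1 : (p ^ n %| N * nL)%N.
  have := congr1 absz int_eq; rewrite abszM !absz_nat => ->.
  by rewrite mulnA dvdn_mulr // dvdn_mull.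
have e0 : (0 < e)%N by move: nL0; rewrite eE muln_gt0 => /andP[].
move: div1; rewrite eE !pfactor_dvdn ?muln_gt0 ?N0 ?e0 ?nK0 //.
by rewrite !lognM ?muln_gt0 ?e0 // /n addnCA -addnA leq_add2r.
Qed.

End WildRamification.

(** * Disks around a fixed point *)

Section Discs.

Variables (vc : rat).
Hypothesis v_c : v (iota c) = vc%:E.
Hypothesis vc_lt0 : vc < 0.
Variable (b : F).
Hypothesis b_fixed : step b = b.

Let bp : b ^+ p = b + iota c.
Proof. by rewrite -[b in RHS]b_fixed /step subrK. Qed.

Let beta := vc / p%:R.

Let beta_lt0 : beta < 0. Proof. by rewrite pmulr_llt0 ?invr_gt0. Qed.

(** As [v c < 0], the term [b ^+ p] dominates [b] in [b ^+ p - b = c]. *)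
Lemma fixed_point_valuation : v b = beta%:E.
Proof.
have [b0|/(v_finite v_val)[u vu]] := eqVneq b 0.
  have := bp; rewrite b0 expr0n gtn_eqF ?prime_gt0 // add0r => c0.
  by have := ic_neq0; rewrite -c0 eqxx.
have cE : iota c = b ^+ p - b by rewrite bp addrC addKr.
have u0 : u < 0.
  rewrite ltNge; apply/negP => u0; have : vge v 0 (iota c).
    rewrite cE; apply: (vgeB v_val); last by apply/(vge_eq _ vu).
    by apply/(vge_eq _ (vX v_val p vu)); rewrite mulr_ge0 // ltW.
  by rewrite (vge_eq _ v_c) leNgt vc_lt0.
have pu : p%:R * u < u by rewrite gtr_nMl // ltr1n prime_gt1.
have := v_c; rewrite cE (vDl v_val (vX v_val p vu) pu); last first.
  by apply/(vgeN v_val)/(vge_eq _ vu).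
by move=> -[] pvc; rewrite vu /beta -pvc; congr (_%:E); rewrite mulrC mulKf // gt_eqF.
Qed.

(* The valuation of the difference of two distinct preimages of a point near
   [b], see [conjugate_distance]. *)
Let thr := beta + tau p.

Let sub_fixed z : z ^+ p - b ^+ p = step z - b.
Proof. by rewrite bp /step opprD addrA addrAC. Qed.

(** The minimal polynomial divides ['X^p - (z ^+ p)%:P], whose roots are simple. *)
Lemma min_poly_roots (E : local_ext j0) (P : {poly E}) z :
  im E (z ^+ p) -> z != 0 -> P \is monic -> irreducible_poly P ->
  root (map_poly (emb E) P) z ->
  exists s : seq F, [/\ uniq s, map_poly (emb E) P = \prod_(u <- s) ('X - u%:P) &
    forall u, u \in s -> u ^+ p = z ^+ p].
Proof.
move=> [w _ wz] z0 Pm Pirr Pz.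
have PX : map_poly (emb E) P %| 'X^p - (z ^+ p)%:P.
  rewrite -wz -map_polyC -(map_polyXn (emb E)) -rmorphB dvdp_map.
  apply: (irreducible_dvd_root Pirr Pz).
  by rewrite rmorphB /= map_polyXn map_polyC /= rootE !hornerE wz subrr.
have [l ul lE] := XnsubC_prod p_prime v_val v_p zeta_prim z0.
have PX' := PX; rewrite lE in PX'; have [m PE] := dvdp_prod_XsubC PX'.
have PE' : map_poly (emb E) P = \prod_(u <- mask m l) ('X - u%:P).
  by apply/eqP; rewrite -eqp_monic ?monic_map ?monic_prod_XsubC.
exists (mask m l); split=> //; first exact: mask_uniq.
move=> u ul'; have : root ('X^p - (z ^+ p)%:P) u.
  by rewrite lE root_prod_XsubC; apply: mem_mask ul'.
by rewrite rootE !hornerE subr_eq0 => /eqP.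
Qed.

Lemma conjugate_distance z u : v z = beta%:E -> u ^+ p = z ^+ p -> u != z ->
  v (u - z) = thr%:E.
Proof.
move=> vz uz ne; have [i ui] := pth_roots p_prime zeta_prim uz.
have i0 : (i : nat) != 0%N by apply: contra_neq ne => i0; rewrite ui i0 expr0 mul1r.
have -> : u - z = (zeta ^+ i - zeta ^+ 0) * z by rewrite ui expr0; ring.
rewrite (vM v_val (v_zsubz p_prime v_val v_p zeta_prim (ltn_ord i) (prime_gt0 p_prime) i0) vz).
by rewrite /thr addrC.
Qed.

Let has_base (E : local_ext j0) := [/\ range iota `<=` im E, im E b & im E zeta].

(** By Krasner's argument: such a [z] is closer to one of the points
[zeta ^+ i * b] than to any other root of ['X^p - (step z)%:P], so that it has
no other conjugate over [E]. *)
Lemma close_preimage (E : local_ext j0) z r : has_base E -> im E (step z) ->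
  p%:R * thr < r -> vge v r (step z - b) -> im E z.
Proof.
move=> [KE bE zetaE] stepE rthr hr.
have Ef := im_subfield E.
rewrite -sub_fixed in hr.
have [i [s [st hs]]] :=
  subX_vge_high p_prime v_val v_p zeta_prim fixed_point_valuation rthr hr.
set y := zeta ^+ i * b in hs.
have vy : v y = beta%:E.
  by rewrite (vM v_val (v_unity p_prime v_val (zX zeta_prim i)) fixed_point_valuation) add0r.
have bs : beta < s by apply: lt_trans st; rewrite ltrDl.
have vz : v z = beta%:E by rewrite -[z](subrK y) addrC (vDl v_val vy bs).
have yE : im E y by apply: subfieldM => //; apply: subfieldX.
have [y' _ y'E] := yE.
have zpE : im E (z ^+ p).
  rewrite -[_ ^+ _](subrK (iota c)); apply: subfieldD => //.
  by apply: KE; exists c.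
have [P [_ [[Pm Pirr Pz] _]]] := adjoin algebraic_base E z.
have [l [ul PE lz]] := min_poly_roots zpE (v_neq0 v_val vz) Pm Pirr Pz.
have all_z u : u \in l -> u = z.
  move=> lu; apply/eqP/negPn/negP => uz.
  have Pu : root (map_poly (emb E) P) u by rewrite PE root_prod_XsubC.
  have := conjugate_valuation hQp v_val j0_v algebraic_base ('X - y'%:P) Pirr Pz Pu.
  rewrite rmorphB /= map_polyX map_polyC /= y'E !hornerE => E1.
  have hu : vge v s (u - y) by rewrite /vge -E1.
  have : vge v s (u - z).
    have -> : u - z = (u - y) - (z - y) by ring.
    exact: (vgeB v_val).
  by rewrite (vge_eq _ (conjugate_distance vz (lz u lu) uz)) leNgt st.
have lE : l = [:: z].
  case: l ul all_z {lz} PE => [|u [|u' l]] /=.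
  - move=> _ _ PE; have := Pz; rewrite PE big_nil rootE !hornerE.
    by rewrite oner_eq0.
  - by move=> _ /(_ u (mem_head _ _)) ->.
  - move=> /andP[nu _] au _; move: nu; rewrite inE negb_or.
    have uz : u = z := au u (mem_head _ _).
    have u'z : u' = z by apply: au; rewrite inE mem_head orbT.
    by rewrite {1}uz u'z eqxx.
exists (- P`_0) => //; rewrite rmorphN -coef_map PE lE big_seq1.
by rewrite coefB coefX coefC sub0r opprK.
Qed.

Lemma level_solutions_seq n :
  exists s : seq F, forall z, level n z -> z \in s.
Proof.
elim: n => [|n [s hs]].
  by exists [:: iota a] => z; rewrite /level /= => ->; rewrite mem_head.
have /choice[rt hrt] := preimage.
exists [seq zeta ^+ i * rt w | w <- s, i <- seq.iota 0 p] => z /level_step zs.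
have [i zi] : exists i : 'I_p, z = zeta ^+ i * rt (step z).
  by apply: (pth_roots p_prime zeta_prim); rewrite hrt /step subrK.
rewrite {1}zi; apply: allpairs_f; first exact: hs.
by rewrite mem_iota ltn_ord.
Qed.

Lemma exists_level n : exists z, level n z.
Proof.
elim: n => [|n [w wn]]; first by exists (iota a).
have [z zw] := preimage w; exists z.
by apply/level_step; rewrite (step_eq zw).
Qed.

Lemma base_adjoined : exists E : local_ext j0, has_base E.
Proof.
have [E [KE sE _]] := adjoin_seq base_ext [:: b; zeta].
by exists E; split=> //; apply: sE; rewrite !inE eqxx ?orbT.
Qed.

(** * Below the critical valuation *)

Section Expanding.

Hypothesis thr_lt0 : thr < 0.

(** Below the threshold, the valuation of [z - b] is divided by [p] when passing
to a preimage; above it, the valuation stays at least [thr]. *)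
Lemma level_close sg n z : sg < 0 -> vge v sg (iota a - b) -> level n z ->
  vge v (Num.min (sg / p%:R ^+ n) thr) (z - b).
Proof.
move=> sg0 hsg; elim: n z => [|n IH] z.
  by rewrite /level /= => ->; apply: vge_le hsg; rewrite expr0 divr1 ge_min lexx.
move=> /level_step/IH hz.
have := subX_vge_low p_prime v_val v_p zeta_prim fixed_point_valuation
  (Ordinal (prime_gt0 p_prime)) (x := z) (s := Num.min (sg / p%:R ^+ n.+1) thr).
rewrite /= expr0 mul1r; apply; first by rewrite ge_min lexx orbT.
rewrite sub_fixed; apply: vge_le hz; rewrite (minr_pMr _ _ (ltW p0)).
have -> : p%:R * (sg / p%:R ^+ n.+1) = sg / p%:R ^+ n.
  have pn : p%:R ^+ n != 0 :> rat by rewrite expf_neq0 // gt_eqF.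
  by rewrite exprS; field; apply/andP; split => //; rewrite gt_eqF.
rewrite le_min !ge_min lexx /=.
have -> : p%:R * thr <= thr by rewrite ger_nMl.
by rewrite orbT.
Qed.

Lemma finite_Kinf : finite_ext iota Kinf.
Proof.
have [sg sg0 hsg] : exists2 sg, sg < 0 & vge v sg (iota a - b).
  have [h|[s vs s1]] := vgeP v_val (- 1) (iota a - b); first by exists (- 1).
  by exists s; [apply: lt_trans s1 _ | apply/(vge_eq _ vs)].
have thr_p : 0 < - (p%:R * thr) by rewrite oppr_gt0 pmulr_rlt0.
have [N hN] := exp_small (- sg) (prime_gt1 p_prime) thr_p.
have close n : (N <= n)%N -> p%:R * thr < Num.min (sg / p%:R ^+ n) thr.
  move=> Nn; rewrite lt_min; apply/andP; split.
    rewrite -ltrN2; apply: le_lt_trans hN; rewrite -mulNr ler_pM2l ?oppr_gt0 //.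
    by rewrite lef_pV2 ?posrE ?exprn_gt0 // ler_eXn2l // ltr1n prime_gt1.
  by rewrite gtr_nMl // ltr1n prime_gt1.
have [E0 [KE0 bE0 zE0]] := base_adjoined.
have [E [E0E low]] : exists E : local_ext j0, im E0 `<=` im E /\
    forall n z, (n <= N)%N -> level n z -> im E z.
  elim: {hN close}N => [|m [E1 [E01 low]]].
    have [s hs] := level_solutions_seq 0.
    have [E [E0E sE _]] := adjoin_seq E0 s; exists E; split=> // n z.
    by rewrite leqn0 => /eqP -> /hs/sE.
  have [s hs] := level_solutions_seq m.+1.
  have [E [E1E sE _]] := adjoin_seq E1 s; exists E; split=> [y /E01/E1E //|n z].
  rewrite leq_eqVlt => /orP[/eqP-> /hs/sE //|nm nz].
  by apply: E1E; apply: low nz.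
have Ebase : has_base E.
  by split=> [y /KE0/E0E //||]; apply: E0E.
have all n z : level n z -> im E z.
  elim: n z => [|n IH] z; first exact: low.
  have [Nn|nN] := leqP N n; last exact: low.
  move=> /level_step nz; apply: (close_preimage Ebase (IH _ nz) (close n Nn)).
  exact: level_close.
apply: (@finite_ext_local E) => //; apply: Kinf_min => //; first exact: im_subfield.
by case: Ebase.
Qed.

End Expanding.

(** * The critical valuation *)

Section Critical.

Hypothesis thr0 : thr = 0.

Section FarBasePoint.

Variable s : rat.
Hypothesis v_ab : v (iota a - b) = s%:E.
Hypothesis s_lt0 : s < 0.

Let sn_lt0 n : s / p%:R ^+ n < 0.
Proof. by rewrite pmulr_llt0 // invr_gt0 exprn_gt0. Qed.

Lemma level_far n z : level n z -> v (z - b) = (s / p%:R ^+ n)%:E.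
Proof.
elim: n z => [|n IH] z.
  by rewrite /level /= => ->; rewrite expr0 divr1.
move=> /level_step/IH; rewrite -sub_fixed => hz.
have lt : s / p%:R ^+ n < p%:R * (beta + tau p) by rewrite -/thr thr0 mulr0.
have := subX_v_low p_prime v_val v_p zeta_prim fixed_point_valuation
  (Ordinal (prime_gt0 p_prime)) lt hz.
by rewrite /= expr0 mul1r exprSr invfM mulrA.
Qed.

(** The fixed point [b] need not belong to the iterated extension, but the
difference of two consecutive points [w], [z] of a backward orbit does, and it
has the same valuation as [w - b]. *)
Lemma Kinf_unbounded_denominators N : (0 < N)%N ->
  ~ (forall x t, Kinf x -> v x = t%:E -> exists k : int, N%:R * t = k%:~R).
Proof.
move=> N0 hN; have NR0 : 0 < N%:R :> rat by rewrite ltr0n.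
have [n hn] := exp_small (- s) (prime_gt1 p_prime) (divr_gt0 ltr01 NR0).
have [w wn] := exists_level n; have [z zw] := preimage w.
have zn : level n.+1 z by apply/level_step; rewrite (step_eq zw).
have vwz : v (w - z) = (s / p%:R ^+ n)%:E.
  have -> : w - z = (w - b) - (z - b) by ring.
  have lt : s / p%:R ^+ n < s / p%:R ^+ n.+1.
    rewrite exprSr invfM mulrA ltr_pdivlMr // -subr_gt0 -[X in _ - X * _]opprK.
    rewrite mulNr opprK; set u := s / _.
    have -> : u + - u * p%:R = - u * (p%:R - 1) by ring.
    by rewrite mulr_gt0 ?oppr_gt0 ?sn_lt0 // subr_gt0 ltr1n prime_gt1.
  apply: (vDl v_val (level_far wn) lt); apply/(vgeN v_val).
  by apply/(vge_eq _ (level_far zn)).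
have [k kE] := hN _ _ (subfieldB Kinf_subfield (level_Kinf wn) (level_Kinf zn)) vwz.
have k0 : k < 0 by rewrite -(ltrz0 rat) -kE pmulr_rlt0.
have k1 : -1 < k.
  rewrite -(ltr_int rat) -kE rmorphN /= ltrNl -mulrN mulrC -mulNr.
  by rewrite -ltr_pdivlMr.
by move: k1; rewrite -lezD1 addNr leNgt k0.
Qed.

Lemma far_infinite : ~ finite_ext iota Kinf.
Proof.
move=> /finite_ext_in_local[E KE].
have [N N0 hN] := value_denominator hQp v_val j0_v E.
by apply: (Kinf_unbounded_denominators N0) => x t /KE; apply: hN.
Qed.

Lemma far_ramified : ~ finitely_ramified iota v Kinf.
Proof.
move=> [e ind].
have [N N0 hN] := value_denominator hQp v_val j0_v base_ext.
apply: (@Kinf_unbounded_denominators (e`! * N)).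
  by rewrite muln_gt0 fact_gt0.
move=> x t Kx vx.
apply: (finite_index_denominator N0 _ _ _ _ ind); last by exists x.
- by exists 1; [exact: (subfield1 Kinf_subfield) | exact: v1].
- move=> u w [y Ky vy] [y' Ky' vy']; exists (y * y'); last exact: vM.
  exact: (subfieldM Kinf_subfield).
- move=> u w [y Ky vy] [y' Ky' vy']; exists (y / y'); last exact: v_div.
  exact: (subfield_div (im_subfield base_ext)).
- by move=> u [y Ky vy]; apply: hN vy.
Qed.

End FarBasePoint.

Section CloseBasePoint.

Hypothesis ab_int : vge v 0 (iota a - b).

Let vge_preimage z (i : 'I_p) : vge v 0 (step z - b) -> vge v 0 (z - zeta ^+ i * b).
Proof.
move=> h; apply: (subX_vge_low p_prime v_val v_p zeta_prim fixed_point_valuation).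
  by rewrite -/thr thr0.
by rewrite mulr0 sub_fixed.
Qed.

Let vge_preimage0 z : vge v 0 (step z - b) -> vge v 0 (z - b).
Proof.
by move/(vge_preimage (Ordinal (prime_gt0 p_prime))); rewrite /= expr0 mul1r.
Qed.

Lemma level_int n z : level n z -> vge v 0 (z - b).
Proof.
elim: n z => [|n IH] z; first by rewrite /level /= => ->.
by move=> /level_step/IH; apply: vge_preimage0.
Qed.

Let v_near z : vge v 0 (z - b) -> v z = beta%:E.
Proof. by move=> h; rewrite -[z](subrK b) addrC (vDl v_val fixed_point_valuation beta_lt0). Qed.

(** For siblings this is [conjugate_distance]. Otherwise the images of [x] and [y]
differ by a unit, which is the product of the integral elements
[x - zeta ^+ i * y]; so [x - y] is a unit. *)
Lemma level_separated n x y : level n x -> level n y -> x != y -> v (x - y) = 0%:E.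
Proof.
elim: n x y => [|n IH] x y.
  by rewrite /level /= => -> ->; rewrite eqxx.
move=> hx hy xy; have vx := v_near (level_int hx); have vy := v_near (level_int hy).
have [sxy|sxy] := eqVneq (step x) (step y).
  have xyp : x ^+ p = y ^+ p by rewrite -[LHS](subrK (iota c)) -/(step x) sxy subrK.
  by rewrite (conjugate_distance vy xyp xy) thr0.
move/level_step: (hx) => hx'; move/level_step: (hy) => hy'.
have v0' := IH _ _ hx' hy' sxy.
have E : x ^+ p - y ^+ p = step x - step y by rewrite /step; ring.
have xy0 : x - y != 0 by rewrite subr_eq0.
have [u vu] := v_finite v_val xy0; rewrite vu; congr (_%:E).
pose i0 := Ordinal (prime_gt0 p_prime).
have vu0 : v (x - zeta ^+ i0 * y) = u%:E by rewrite /= expr0 mul1r.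
apply/eqP; rewrite eq_le; apply/andP; split; rewrite leNgt; apply/negP => hu.
  have : vge v u (step x - step y).
    rewrite -E (subX_prod p_prime zeta_prim) (bigD1 i0) //= -[u]addr0.
    apply: (vgeM v_val); first exact/(vge_eq _ vu0).
    apply: (@big_ind _ (vge v 0)) => [|x1 x2|i _]; first by rewrite /vge (v1 v_val).
      exact: vgeM0.
    have -> : x - zeta ^+ i * y = (x - zeta ^+ i * b) - zeta ^+ i * (y - b) by ring.
    apply: (vgeB v_val); first by apply: vge_preimage; apply: level_int hx'.
    apply: (vgeM0 v_val); last exact: level_int hy.
    by apply/(vge_eq _ (v_unity p_prime v_val (zX zeta_prim i))).
  by rewrite (vge_eq _ v0') leNgt hu.
have ut : u < beta + tau p by rewrite -/thr thr0.
have := subX_v p_prime v_val v_p zeta_prim vy vu0 ut.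
rewrite E v0' => -[] /esym/eqP; rewrite mulf_eq0 gt_eqF //= => /eqP u0.
by rewrite u0 ltxx in hu.
Qed.

Hypothesis distinct : forall n, distinct_roots (poly_iter f n - (iota a)%:P).

Let size_f : size f = p.+1.
Proof. by rewrite size_XnsubC // prime_gt0. Qed.

Lemma many_solutions n : exists s : seq F, [/\ uniq s, size s = (p ^ n)%N &
  forall z, z \in s -> level n z].
Proof.
have [s sE us] := distinct n; exists s.
have sz : (size (poly_iter f n)).-1 = (p ^ n)%N.
  elim: n {s sE us} => [|n IH]; first by rewrite size_polyX.
  by rewrite /= size_comp_poly -/(poly_iter f n) IH size_f /= expnS.
have sz' : size (poly_iter f n) = (p ^ n).+1.
  rewrite -sz prednK // lt0n; apply/eqP => sz0.
  by have := expn_gt0 p n; rewrite -sz sz0 (prime_gt0 p_prime).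
have szq : size (poly_iter f n - (iota a)%:P) = (p ^ n).+1.
  rewrite size_polyDl // size_polyN sz'; apply: leq_ltn_trans (size_polyC_leq1 _) _.
  by rewrite ltnS expn_gt0 prime_gt0.
have lc0 : lead_coef (poly_iter f n - (iota a)%:P) != 0.
  by rewrite lead_coef_eq0 -size_poly_eq0 szq.
split=> //.
  by move: szq; rewrite sE size_scale // size_prod_XsubC => -[].
move=> z zs; apply/level_solutions; rewrite /solutions /= sE rootZ //.
by rewrite root_prod_XsubC.
Qed.

(** The [p ^ n] points of level [n] lie in as many residue classes. *)
Lemma close_infinite : ~ finite_ext iota Kinf.
Proof.
move=> /finite_ext_in_local[E KE]; have [M hM] := finite_residue p_prime hQp v_val j0_v E.
have [s [us sz ls]] := many_solutions M.
have := hM s _ us _; rewrite sz leqNgt ltn_expl ?prime_gt1 //= => h.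
suff : false by []; apply: h; first by move=> x /ls/level_Kinf/KE.
by move=> x y /ls hx /ls hy; apply: level_separated hx hy.
Qed.

(** Adjoining a preimage [z] is unramified: the conjugates of [z - b] lie in
distinct residue classes, so that by interpolation the valuation of a
polynomial expression in [z - b] is that of one of its coefficients. *)
Lemma unramified_preimage (E : local_ext j0) z : has_base E ->
  im E (step z) -> vge v 0 (step z - b) ->
  exists E' : local_ext j0, [/\ im E `<=` im E', im E' z &
    forall x t, im E' x -> v x = t%:E -> exists2 y, im E y & v y = t%:E].
Proof.
move=> [KE bE zetaE] stepE step_int.
have Ef := im_subfield E; have z_int := vge_preimage0 step_int.
have vz := v_near z_int; have [b' _ b'E] := bE.
have zpE : im E (z ^+ p).
  rewrite -[_ ^+ _](subrK (iota c)); apply: subfieldD => //.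
  by apply: KE; exists c.
have [P [E' [[Pm Pirr Pz] [EE' zE' E'E]]]] := adjoin algebraic_base E z.
have [l [ul PE lz]] := min_poly_roots zpE (v_neq0 v_val vz) Pm Pirr Pz.
exists E'; split=> // x t /E'E[q ->] vq.
pose r := (q %% P) \Po ('X + b'%:P).
have P0 := monic_neq0 Pm.
have rE u : root (map_poly (emb E) P) u ->
    (map_poly (emb E) r).[u - b] = (map_poly (emb E) q).[u].
  move=> /rootP Pu; rewrite /r map_comp_poly horner_comp rmorphD /= map_polyX map_polyC /=.
  rewrite !hornerE b'E subrK [in RHS](divp_eq q P) rmorphD rmorphM /=.
  by rewrite hornerD hornerM Pu mulr0 add0r.
have lP u : u \in l -> root (map_poly (emb E) P) u by rewrite PE root_prod_XsubC.
have l_int u : u \in l -> vge v 0 (u - b).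
  by move=> lu; apply: vge_preimage0; rewrite /step (lz u lu).
have sep u u' : u \in l -> u' \in l -> u != u' -> v (u - u') = 0%:E.
  move=> lu lu' uu'; rewrite -thr0; apply: conjugate_distance => //.
    exact/v_near/l_int.
  by rewrite (lz u lu) (lz u' lu').
pose s := [seq u - b | u <- l].
have coef_ge : forall i, vge v t (map_poly (emb E) r)`_i.
  apply: (@interpolation_bound _ v s) => //.
  - rewrite size_map_poly size_map size_comp_poly2 ?size_XaddC // -ltnS.
    by rewrite -(size_prod_XsubC l id) -PE size_map_poly ltn_modp.
  - by rewrite map_inj_uniq // => u u' /addIr.
  - by move=> _ /mapP[u lu ->]; apply: l_int.
  - move=> _ _ /mapP[u lu ->] /mapP[u' lu' ->] ne.
    have -> : u - b - (u' - b) = u - u' by ring.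
    by apply: sep => //; apply: contra_neq ne => ->.
  move=> _ /mapP[u lu ->]; rewrite rE ?lP //.
  have := conjugate_valuation hQp v_val j0_v algebraic_base q Pirr Pz (lP u lu).
  by rewrite /vge => <-; rewrite vq.
have zr : (map_poly (emb E) r).[z - b] = \sum_(i < size r) (emb E) r`_i * (z - b) ^+ i.
  by rewrite horner_coef size_map_poly; apply: eq_bigr => i _; rewrite coef_map.
have [i ri] : exists i : 'I_(size r), v (emb E r`_i) = t%:E.
  apply: contrapT => no.
  have [t' tt' ht'] : exists2 t', t < t' & forall i : 'I_(size r), vge v t' (emb E r`_i).
    have : forall ll : seq 'I_(size r), exists2 t', t < t' &
        forall i, i \in ll -> vge v t' (emb E r`_i).
      elim=> [|i ll [t' tt' ht']]; first by exists (t + 1) => //; rewrite ltrDl.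
      have [u tu hu] : exists2 u, t < u & vge v u (emb E r`_i).
        have [h|[u vu _]] := vgeP v_val (t + 1) (emb E r`_i).
          by exists (t + 1) => //; rewrite ltrDl.
        exists u; last by apply/(vge_eq _ vu).
        have := coef_ge i; rewrite coef_map (vge_eq _ vu) le_eqVlt => /predU1P[tu|//].
        by case: no; exists i; rewrite vu tu.
      exists (Num.min t' u) => [|k]; first by rewrite lt_min tt'.
      rewrite inE => /predU1P[->|kl].
        by apply: vge_le hu; rewrite ge_min lexx orbT.
      by apply: vge_le (ht' k kl); rewrite ge_min lexx.
    move=> /(_ (enum 'I_(size r)))[t' tt' ht']; exists t' => // i.
    by apply: ht'; rewrite mem_enum.
  have : vge v t' (map_poly (emb E) q).[z].
    rewrite -rE // zr; apply: (vge_sum v_val) => i _; rewrite mulrC.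
    apply: (vgeM0 v_val) => //.
    by have := vgeX v_val i z_int; rewrite mulr0.
  by rewrite (vge_eq _ vq) leNgt tt'.
by exists (emb E r`_i) => //; exists r`_i.
Qed.

Lemma unramified_orbit (E : local_ext j0) (s : seq F) : has_base E ->
  (forall z, z \in s -> exists n, level n z) ->
  exists E' : local_ext j0, [/\ has_base E', forall z, z \in s -> im E' z &
    forall x t, im E' x -> v x = t%:E -> exists2 y, im E y & v y = t%:E].
Proof.
move=> baseE; pose good (E' : local_ext j0) := im E `<=` im E' /\
  forall x t, im E' x -> v x = t%:E -> exists2 y, im E y & v y = t%:E.
have base' E' : good E' -> has_base E'.
  by case: baseE => KE bE zE [EE' _]; split=> [y /KE/EE' //||]; apply: EE'.
have one n z (E1 : local_ext j0) : good E1 -> level n z ->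
    exists E2 : local_ext j0, [/\ good E2, im E1 `<=` im E2 & im E2 z].
  elim: n z => [|n IH] z gE1.
    rewrite /level /= => ->; exists E1; split=> //.
    by case: (base' _ gE1) => KE1 _ _; apply: KE1; exists a.
  move=> /level_step nz; have [E2 [gE2 E12 E2z]] := IH _ gE1 nz.
  have [E3 [E23 E3z val]] := unramified_preimage (base' _ gE2) E2z (level_int nz).
  exists E3; split=> //; last by move=> y /E12/E23.
  split; first by move=> y; case: gE2 => EE2 _ /EE2/E23.
  move=> x t E3x vx; have [y E2y vy] := val x t E3x vx.
  by case: gE2 => _; apply; [exact: E2y|].
have all (l : seq F) : (forall z, z \in l -> exists n, level n z) ->
    exists E' : local_ext j0, good E' /\ forall z, z \in l -> im E' z.
  elim: l => [|z l IH] hl.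
    by exists E; split=> //; split=> // x t Ex vx; exists x.
  have [|E1 [gE1 E1l]] := IH; first by move=> u lu; apply: hl; rewrite inE lu orbT.
  have [n nz] := hl z (mem_head _ _).
  have [E2 [gE2 E12 E2z]] := one n z E1 gE1 nz.
  by exists E2; split=> // u; rewrite inE => /predU1P[->|/E1l/E12].
move=> /all[E' [gE' sE']]; exists E'; split=> //; first exact: base'.
by case: gE'.
Qed.

(** Every element of the iterated extension lies in a field generated by finitely
many points of the backward orbit, which has the same value group as the field
generated by [K], [b] and [zeta]. *)
Lemma close_finitely_ramified : finitely_ramified iota v Kinf.
Proof.
have [E baseE] := base_adjoined.
have [N N0 hN] := value_denominator hQp v_val j0_v E.
have Kden x t : Kinf x -> v x = t%:E -> exists k : int, N%:R * t = k%:~R.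
  move=> /field_gen_finitary[s sS sx] vx.
  have [z /sS[n _ /level_solutions nz]|E' [baseE' sE' val]] :=
    unramified_orbit (s := s) baseE; first by exists n.
  have E'x : im E' x.
    by apply: sx => //; [exact: im_subfield | case: baseE'].
  by have [y Ey vy] := val x t E'x vx; apply: hN vy.
have [n n0 KE] := value_lattice Kinf_subfield N0 Kden.
have [nK nK0 KKE] := local_lattice (im_subfield base_ext) (@subset_refl _ _).
have [e _ ind] : exists2 e, n = (e * nK)%N &
    has_index (value_group v Kinf) (value_group v (range iota)) e.
  apply: (lattice_index n0 nK0 KE KKE) => g [w Kw vw]; exists w => //.
  exact: K_Kinf.
by exists e.
Qed.

End CloseBasePoint.

End Critical.

End Discs.

End Dynamics.

Local Close Scope classical_set_scope.

Theorem theorem1p3 (p : nat) (p_prime : prime p)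
    (Qp : fieldType) (vp : Qp -> \bar rat) (hQp : is_padic_numbers p vp)
    (K : fieldExtType Qp)
    (Kbar : closedFieldType) (iota : {rmorphism K -> Kbar})
    (Kbar_alg : forall x : Kbar, algebraicOver iota x)
    (v : Kbar -> \bar rat) (v_val : is_valuation v)
    (v_ext : forall x : Qp, v (iota x%:A) = vp x)
    (c : K) (c_neq0 : c != 0) (a : K) :
  let f : {poly Kbar} := 'X^p - (iota c)%:P in
  (forall n : nat, distinct_roots (poly_iter f n - (iota a)%:P)) ->
  let Kinf := K_infty iota f (iota a) in
  let t : rat := - (p%:R / (p%:R - 1)) in
  [/\ (v (iota c) < t%:E)%E -> finite_ext iota Kinf,
      v (iota c) = t%:E ->
        ~ finite_ext iota Kinf /\
        (finitely_ramified iota v Kinf <->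
         exists b : Kbar, f.[b] = b /\ (0 <= v (iota a - b)%R)%E) &
      (t%:E < v (iota c))%E -> infinitely_wildly_ramified p iota v Kinf].
Proof.
move=> f distinct Kinf t.
have p0 : (0 : rat) < p%:R by rewrite ltr0n prime_gt0.
have v_p : v p%:R = 1%:E.
  by rewrite -(vp_p p_prime hQp) -v_ext scaler_nat rmorph_nat.
have [zeta zeta_prim] := prime_primitive_root p_prime v_val v_p.
have [vc v_c] : exists vc, v (iota c) = vc%:E.
  by apply: (v_finite v_val); rewrite fmorph_eq0.
have tE : t = - (p%:R * tau p) by [].
have t_lt0 : t < 0 by rewrite tE oppr_lt0 mulr_gt0 ?tau_gt0.
have f_step z : f.[z] = step p iota c z by apply: horner_step.
have [b b_fixed] : exists b, step p iota c b = b.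
  have p1 := prime_gt1 p_prime.
  have sX : size ('X^p - 'X : {poly Kbar}) = p.+1.
    by rewrite size_polyDl ?size_polyXn // size_polyN size_polyX ltnS.
  have : size ('X^p - 'X - (iota c)%:P) != 1.
    rewrite size_polyDl ?sX ?eqSS -?lt0n ?prime_gt0 //.
    rewrite size_polyN; apply: leq_ltn_trans (size_polyC_leq1 _) _.
    by rewrite ltnS prime_gt0.
  move=> /closed_rootP[b]; rewrite rootE !hornerE /step => /eqP h; exists b.
  by apply/eqP; rewrite -subr_eq0 addrAC h.
rewrite v_c lte_fin lte_fin; split=> [vct|[vct]|tvc].
- apply: (finite_Kinf p_prime hQp Kbar_alg v_val v_ext a c_neq0 zeta_prim v_c _ b_fixed).
    exact: lt_trans t_lt0.
  have -> : vc / p%:R + tau p = (vc - t) / p%:R by rewrite tE; field; rewrite gt_eqF.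
  by rewrite pmulr_llt0 ?invr_gt0 // subr_lt0.
- have vc0 : vc < 0 by rewrite vct.
  have thr0 : vc / p%:R + tau p = 0 by rewrite vct tE; field; rewrite gt_eqF.
  have far b' s : step p iota c b' = b' -> v (iota a - b') = s%:E -> s < 0 ->
      ~ finite_ext iota Kinf /\ ~ finitely_ramified iota v Kinf.
    move=> b'_fixed vab s0; split.
      exact: (far_infinite p_prime hQp Kbar_alg v_val v_ext c_neq0 zeta_prim v_c vc0 b'_fixed thr0 vab s0).
    exact: (far_ramified p_prime hQp v_val v_ext c_neq0 zeta_prim v_c vc0 b'_fixed thr0 vab s0).
  have close b' : step p iota c b' = b' -> vge v 0 (iota a - b') ->
      ~ finite_ext iota Kinf /\ finitely_ramified iota v Kinf.
    move=> b'_fixed vab; split.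
      exact: (close_infinite p_prime hQp Kbar_alg v_val v_ext c_neq0 zeta_prim v_c vc0 b'_fixed thr0 vab distinct).
    exact: (close_finitely_ramified p_prime hQp Kbar_alg v_val v_ext c_neq0 zeta_prim v_c vc0 b'_fixed thr0 vab).
  split.
    have [h|[s vs s0]] := vgeP v_val 0 (iota a - b); first by case: (close b b_fixed h).
    by case: (far b s b_fixed vs s0).
  split=> [fr|[b' [fb' h]]]; last by rewrite f_step in fb'; case: (close b' fb' h).
  exists b; split; first by rewrite f_step.
  have [//|[s vs s0]] := vgeP v_val 0 (iota a - b).
  by case: (far b s b_fixed vs s0).
- apply: (infinitely_wild p_prime hQp Kbar_alg v_val v_ext a c_neq0 zeta_prim v_c).
  by rewrite -tE.
Qed.
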